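(* With the notation of the context, for each $d\mid N$ let $N_d=N/d$, $G_{N_d}=(\mathbb Z/N_d\mathbb Z)^\times$, $\widehat G_{N_d}$ its character group, $\widehat G_{N_d}^{+}=\{\chi:\chi(-1)=1\}$ and $\widehat G_{N_d}^{-}=\{\chi:\chi(-1)=-1\}$. Then $$\det(X_N)=\mathrm{i}^{-\frac{(N-1)(3N-2)}{2}}N^{-\frac N2}\prod_{d\mid N}\prod_{\chi\in\widehat G_{N_d}}\Bigl(d\sum_{t\in G_{N_d}}\widehat x_d(t)\chi(t)\Bigr),$$ $$\det(Y_N)=(-1)^{\frac{N^+(N^++1)}{2}}2^{N^++1-N^-}N^{-\frac{N^++1}{2}}\prod_{d\mid N}\prod_{\chi\in\widehat G_{N_d}^{+}}\Bigl(d\sum_{t\in G_{N_d}}\widehat y_d(t)\chi(t)\Bigr),$$ $$\det(Z_N)=(-1)^{\frac{N^-(N^--1)}{2}}N^{-\frac{N^-}{2}}\prod_{d\mid N,\ N_d>2}\ \prod_{\chi\in\widehat G_{N_d}^{-}}\Bigl(d\sum_{t\in G_{N_d}}\widehat z_d(t)\chi(t)\Bigr).$$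
   Context: Throughout, $\mathrm{i}=\sqrt{-1}$, $N\ge2$, $N^+=\lfloor N/2\rfloor$, $N^-=\lfloor (N-1)/2\rfloor$, $\omega_M=e^{2\pi\mathrm{i}/M}$. For $a\in\mathbb Z/N\mathbb Z$, $\bar a\in\{0,\dots,N-1\}$ is its standard representative and $[a]=\{\pm a\}$ its orbit in $(\mathbb Z/N\mathbb Z)/\{\pm1\}$, identified with the representatives $\{0,1,\dots,N^+\}$. Let $x_a$ ($a\in\mathbb Z/N\mathbb Z$) be commuting indeterminates and $X_N=(x_{\overline{ij}})_{0\le i,j\le N-1}$. Let $y_{[a]}$ be commuting indeterminates and $Y_N=(y_{[ij]})_{0\le i,j\le N^+}$. Let $z_r$ ($1\le r\le N^-$) be commuting indeterminates, extended to all $a\in\mathbb Z/N\mathbb Z$ by $z_{\langle a\rangle}=0$ if $a=0$ or ($N$ even and $a=N/2$), $z_{\langle a\rangle}=z_a$ if $1\le \bar a\le N^-$, $z_{\langle a\rangle}=-z_{N-\bar a}$ if $N^-<\bar a\le N-1$; and $Z_N=(z_{\langle ij\rangle})_{1\le i,j\le N^-}$. For $d\mid N$ let $N_d=N/d$, $N_d^-=\lfloor (N_d-1)/2\rfloor$, and for $t\in\mathbb Z/N_d\mathbb Z$: $\widehat x_d(t)=\sum_{r=0}^{N_d-1}x_{\overline{dr}}\,\omega_{N_d}^{tr}$; $\widehat y_d(t)=\tfrac12 y_{[0]}+\tfrac12\mathbf 1_{2\mid N_d}\,y_{[N/2]}(-1)^t+\sum_{r=1}^{N_d^-}y_{[dr]}\cos(2\pi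 tr/N_d)$; $\widehat z_d(t)=\sum_{r=1}^{N_d^-}z_{\langle dr\rangle}\sin(2\pi tr/N_d)$. For $N_d=1$, $G_1$ is the trivial group $\{0\}$ with only the trivial character (which is even). *)

(* Defs.v *)
From mathcomp Require Import all_boot all_order all_algebra.
From mathcomp Require Import complex.
From mathcomp Require Import -(notations) mpoly.
From mathcomp Require Import classical_sets fsbigop reals exp trigo.

Set Implicit Arguments.
Unset Strict Implicit.
Unset Printing Implicit Defensive.

Import GRing.Theory Num.Theory.
Local Open Scope ring_scope.
Local Open Scope complex_scope.

(* The notations of mpoly are not imported because they clash with those of
   MathComp-Analysis. *)
Notation "{ 'mpoly' T [ n ] }" := (mpoly n T)
  (at level 0, T, n at level 2, format "{ 'mpoly'  T [ n ] }") : type_scope.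

(* Elements of Z/N are given by natural numbers a (any representative). *)

Definition Nplus (N : nat) : nat := (N %/ 2)%N.
Definition Nminus (N : nat) : nat := ((N - 1) %/ 2)%N.

(* The k-th of the n indeterminates, k = 0, ..., n - 1. The value 0 for k >= n
   is never used below when N > 0. *)
Definition indet (R : realType) (n k : nat) : {mpoly R[i][n]} :=
  if insub k is Some i then mpolyX R[i] (mnm1 (i : 'I_n)) else 0.

Definition xvar (R : realType) (N a : nat) : {mpoly R[i][N]} :=
  indet R N (a %% N).

(* The representative of {a, -a} in {0, ..., N^+} is min(b, N - b), where b is
   the standard representative of a. *)
Definition yvar (R : realType) (N a : nat) : {mpoly R[i][(Nplus N).+1]} :=
  indet R (Nplus N).+1 (minn (a %% N) (N - a %% N)).

(* z_r, for 1 <= r <= N^-, is the indeterminate with index r - 1. *)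
Definition zvar (R : realType) (N a : nat) : {mpoly R[i][Nminus N]} :=
  let b := (a %% N)%N in
  if (b == 0)%N || (2 * b == N)%N then 0
  else if (b <= Nminus N)%N then indet R (Nminus N) (b - 1)
  else - indet R (Nminus N) (N - b - 1).

Definition Xmx (R : realType) (N : nat) : 'M[{mpoly R[i][N]}]_N :=
  \matrix_(i < N, j < N) xvar R N (i * j).

Definition Ymx (R : realType) (N : nat) :
    'M[{mpoly R[i][(Nplus N).+1]}]_((Nplus N).+1) :=
  \matrix_(i < (Nplus N).+1, j < (Nplus N).+1) yvar R N (i * j).

Definition Zmx (R : realType) (N : nat) :
    'M[{mpoly R[i][Nminus N]}]_(Nminus N) :=
  \matrix_(i < Nminus N, j < Nminus N) zvar R N (i.+1 * j.+1).

(* exp (2 i pi / M), by Euler's formula *)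
Definition omega (R : realType) (M : nat) : R[i] :=
  cos (2 * pi / M%:R) +i* sin (2 * pi / M%:R).

Definition xhat (R : realType) (N d t : nat) : {mpoly R[i][N]} :=
  let M := (N %/ d)%N in
  \sum_(0 <= r < M) omega R M ^+ (t * r) *: xvar R N (d * r).

Definition yhat (R : realType) (N d t : nat) : {mpoly R[i][(Nplus N).+1]} :=
  let M := (N %/ d)%N in
  (2^-1 : R[i]) *: yvar R N 0
  + (if (2 %| M)%N
     then (2^-1 * (-1) ^+ t : R[i]) *: yvar R N (N %/ 2) else 0)
  + \sum_(1 <= r < (Nminus M).+1)
      (cos (2 * pi * t%:R * r%:R / M%:R))%:C *: yvar R N (d * r).

Definition zhat (R : realType) (N d t : nat) : {mpoly R[i][Nminus N]} :=
  let M := (N %/ d)%N in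
  \sum_(1 <= r < (Nminus M).+1)
    (sin (2 * pi * t%:R * r%:R / M%:R))%:C *: zvar R N (d * r).

(* The units of Z/M, by their standard representatives. This is not
   {unit 'Z_M} because 'Z_1 is Z/2, whereas zunit 1 only contains 0. *)
Definition zunit (M : nat) : finType := {t : 'I_M | coprime t M}.

Definition zval (M : nat) (t : zunit M) : nat := val (val t).

(* Group homomorphisms from the units of Z/M to the nonzero complex numbers. *)
Definition is_character (R : realType) (M : nat)
    (chi : {ffun zunit M -> R[i]}) : Prop :=
  [/\ (forall s, chi s != 0),
      (forall e, zval e = 1 %[mod M] -> chi e = 1) &
      (forall s t u, zval u = zval s * zval t %[mod M] ->
         chi u = chi s * chi t)].

(* The element e with e + 1 = 0 mod M is -1. *)
Definition value_at_m1 (R : realType) (M : nat)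
    (chi : {ffun zunit M -> R[i]}) (c : R[i]) : Prop :=
  forall e : zunit M, zval e + 1 = 0 %[mod M] -> chi e = c.

Definition characters (R : realType) (M : nat) :
    set {ffun zunit M -> R[i]} :=
  [set chi | is_character chi]%classic.

Definition even_characters (R : realType) (M : nat) :
    set {ffun zunit M -> R[i]} :=
  [set chi | is_character chi /\ value_at_m1 chi 1]%classic.

Definition odd_characters (R : realType) (M : nat) :
    set {ffun zunit M -> R[i]} :=
  [set chi | is_character chi /\ value_at_m1 chi (-1)]%classic.

Arguments characters : clear implicits.
Arguments even_characters : clear implicits.
Arguments odd_characters : clear implicits.

(* Main.v *)
(* Let f be a function on Z/N, all functions being even (for Y), odd (for Z) or
   arbitrary (for X). By Fourier inversion the matrix (x_{ij}) factors as K A up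
   to a scalar, where K is the matrix of the discrete Fourier (or cosine, or
   sine) transform and A is the matrix of the operator f |-> sum_s xhat(s) f(. s),
   a combination of the operators of multiplication by s on Z/N.
   The operators f |-> [gcd(a, N) = d] f(a u), for d | N and u a unit modulo N/d,
   commute and have finite order up to projections, so they have a common
   eigenbasis; its members are supported on a single class gcd(a, N) = d, where
   they are given by a character of the units of Z/(N/d), and each character of
   the right parity occurs once. In this basis A is triangular for divisibility
   of the levels d, and its diagonal entries are the character sums.
   Finally det K is a Vandermonde determinant (for Y and Z through Chebyshev
   polynomials), which gives its argument, and the orthogonality relations give
   its modulus. *)

Require Import Defs.
From mathcomp Require Import all_boot all_order all_algebra.
From mathcomp Require Import perm cyclic complex.
From mathcomp Require Import -(notations) mpoly.
From mathcomp Require Import zify ring lra.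
From mathcomp Require Import classical_sets fsbigop reals exp trigo.

Set Implicit Arguments.
Unset Strict Implicit.
Unset Printing Implicit Defensive.

Import Order.TTheory GRing.Theory Num.Theory.
Local Open Scope ring_scope.
Local Open Scope complex_scope.

(** The three cases differ only in a pair [(h, eps)], with [h] standing for 1 or -1: the functions
    considered satisfy f(h a) = eps f(a). Multiplication by a non-unit s need not be diagonalizable
    (s = 2 modulo 4 is not), so the operators f |-> f(. s) have no common eigenbasis in general.
    This is why they are cut down to one class gcd(a, N) = d, where u ranges over a finite group.
    Levels are only partially ordered by divisibility and the eigenbasis comes in no particular
    order. Instead of sorting a matrix into triangular form, det(P A) is compared with det P inside
    the Leibniz expansion, P being the matrix of the eigenbasis. Powers of two: inverting the folded
    transforms costs 2/N per row, while the cosine matrix squares to N only after each column is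
    weighted by the size of its orbit {k, -k}, which is 2 for N^- columns and 1 for the others. This
    leaves 2^(N^+ + 1 - N^-). For sines every orbit has size 2 and nothing is left. *)

(* The terms of the Leibniz expansions vanish unless ck (s i) <= rk i for all i;
   since the ck and the rk have the same sum, equality then holds throughout. *)
Lemma det_scaled_leibniz (L : comNzRingType) (n : nat) (B P : 'M[L]_n)
    (lam : 'I_n -> L) (rk ck : 'I_n -> nat) :
    (forall i j, (rk i < ck j)%N -> B i j = 0) ->
    (forall i j, ck j != rk i -> P i j = 0) ->
    (forall i j, ck j = rk i -> B i j = lam i * P i j) ->
  \det P != 0 -> \det B = (\prod_i lam i) * \det P.
Proof.
move=> B0 P0 BP detP.
(* A nonzero term in the expansion of [\det P] is a permutation matching [ck] with [rk]; the
   equality of their sums follows. *)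
have [s0 s0P] : exists s0 : 'S_n, forall i, ck (s0 i) = rk i.
  have [s0 /forallP s0P|no] := pickP [pred s : 'S_n | [forall i, ck (s i) == rk i]].
    by exists s0 => i; apply/eqP.
  case/negP: detP; apply/eqP; rewrite /determinant big1 // => s _.
  have /negbT := no s; rewrite /= negb_forall => /existsP[i ni].
  by rewrite (bigD1 i) //= P0 // mul0r mulr0.
have sum_ck (s : 'S_n) : (\sum_i ck (s i) = \sum_i rk i)%N.
  have E (t : 'S_n) : (\sum_i ck (t i) = \sum_i ck i)%N.
    by rewrite [RHS](reindex_inj (@perm_inj _ t)).
  by rewrite E -(E s0); apply: eq_bigr => i _; rewrite s0P.
rewrite /determinant mulr_sumr; apply: eq_bigr => s _.
rewrite mulrCA -big_split /=; congr (_ * _).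
have [/forallP sP|] := boolP [forall i, ck (s i) == rk i].
  by apply: eq_bigr => i _; rewrite BP //; apply/eqP.
rewrite negb_forall => /existsP[i ni].
rewrite [RHS](bigD1 i) //= P0 // mulr0 mul0r.
have [/existsP[k lt_k]|] := boolP [exists k, rk k < ck (s k)]%N.
  by rewrite (bigD1 k) //= B0 // mul0r.
rewrite negb_exists => /forallP ge_k; case/eqP: ni.
have le_k k : (ck (s k) <= rk k)%N by rewrite leqNgt ge_k.
have /leqif_sum := fun k (_ : predT k) => leqif_eq (le_k k).
by move=> /leqifP; rewrite sum_ck; case: ifP => [/forallP/(_ i)/eqP //|_]; rewrite ltnn.
Qed.

(** * Classes of Z/N under the gcd, and units modulo N/d *)

(** With [d = gcdn a N], the quotient [a %/ d] is prime to [N %/ d] and stays so after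
    multiplication by [u]. Hence the units modulo N/d act on the class of gcd d. *)
Lemma gcdn_mul_unit (N a u : nat) :
  (0 < N)%N -> coprime u (N %/ gcdn a N) -> gcdn (a * u) N = gcdn a N.
Proof.
move=> N0; set d := gcdn a N => cop.
have d0 : (0 < d)%N by rewrite gcdn_gt0 N0 orbT.
have [da dN] : (d %| a)%N /\ (d %| N)%N by rewrite dvdn_gcdl dvdn_gcdr.
have Ed : (a %/ d * d = a)%N by rewrite divnK.
have EN : (N %/ d * d = N)%N by rewrite divnK.
rewrite -{1}Ed -{1}EN mulnAC -muln_gcdl -[RHS]mul1n; congr (_ * _)%N.
have cad : coprime (a %/ d) (N %/ d).
  rewrite /coprime -(eqn_pmul2r d0) muln_gcdl Ed EN mul1n //.
by apply/eqP; rewrite -/(coprime _ _) coprimeMl cad.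
Qed.

(** Converse of the above: only the units modulo N/d preserve the class, so they alone contribute to
    the diagonal entries of A. *)
Lemma gcdn_mul_eq (N a s : nat) :
  (0 < N)%N -> gcdn (a * s) N = gcdn a N -> coprime s (N %/ gcdn a N).
Proof.
move=> N0; set d := gcdn a N => eqd.
have d0 : (0 < d)%N by rewrite gcdn_gt0 N0 orbT.
have [da dN] : (d %| a)%N /\ (d %| N)%N by rewrite dvdn_gcdl dvdn_gcdr.
have Ed : (a %/ d * d = a)%N by rewrite divnK.
have EN : (N %/ d * d = N)%N by rewrite divnK.
move: eqd; rewrite -{1}Ed -{1}EN mulnAC -muln_gcdl -[in RHS](mul1n d) => /eqP.
by rewrite eqn_pmul2r // -/(coprime _ _) coprimeMl => /andP[].
Qed.

Lemma zunit_exists (M u : nat) :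
  (0 < M)%N -> coprime u M -> exists t : zunit M, zval t = (u %% M)%N.
Proof.
move=> M0 cop.
have lt : (u %% M < M)%N by rewrite ltn_mod.
have cop' : coprime (Ordinal lt) M by rewrite /= coprime_modl.
by exists (exist _ (Ordinal lt) cop').
Qed.

Lemma zval_lt (M : nat) (t : zunit M) : (zval t < M)%N.
Proof. exact: ltn_ord. Qed.

Lemma zval_coprime (M : nat) (t : zunit M) : coprime (zval t) M.
Proof. by case: t. Qed.

Lemma zval_inj (M : nat) : injective (@zval M).
Proof. by move=> s t /val_inj/val_inj. Qed.

Lemma eqmod_mul_dvd (N d a u v : nat) :
    (d %| N)%N -> (d %| a)%N -> u = v %[mod N %/ d] ->
  (a * u = a * v %[mod N])%N.
Proof.
move=> dN /dvdnP[b ->] uv.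
case: (posnP N) => [N0|N0].
  by move: uv; rewrite N0 div0n !modn0 => ->.
have -> : N = (N %/ d * d)%N by rewrite divnK.
rewrite -!mulnA -[(d * u)%N]mulnC -[(d * v)%N]mulnC !mulnA -!muln_modl.
by rewrite -modnMmr uv modnMmr.
Qed.

Lemma coprime_expn_inv (M u : nat) : (0 < M)%N -> coprime u M ->
  exists2 v, coprime v M & u * v = 1 %[mod M].
Proof.
move=> M0 cop; exists (u ^ (totient M).-1)%N; first by rewrite coprimeXl.
by rewrite -expnS prednK ?totient_gt0 // Euler_exp_totient.
Qed.

(** * Common eigenbasis of the multiplication operators *)

Lemma divisor_quo_gt0 (N d : nat) : (0 < N)%N -> (d %| N)%N -> (0 < N %/ d)%N.
Proof. by move=> N0 dN; rewrite divn_gt0 ?(dvdn_gt0 N0 dN) // dvdn_leq. Qed.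

Section Equivariant.

Variables (R : realType) (N h : nat) (eps : R[i]).
Hypotheses (N0 : (0 < N)%N) (coph : coprime h N).

(** Functions on Z/N, given on all representatives. The pair [(h, eps)] will be (1, 1) for X, (N -
    1, 1) for Y and (N - 1, -1) for Z, where N - 1 stands for -1. *)
Definition equivariant (f : nat -> R[i]) : Prop :=
  (forall a b, a = b %[mod N] -> f a = f b) /\
  (forall a, f (h * a)%N = eps * f a).

Definition equivariant_characters (M : nat) : set {ffun zunit M -> R[i]} :=
  [set chi | is_character chi /\
             (forall e : zunit M, zval e = h %[mod M] -> chi e = eps)]%classic.

(** The [c k] form the basis of the equivariant functions dual to evaluation at the points [rep j].
    The dimension is a successor so that the square matrices form a ring, in which powers and
    polynomials make sense. *)
Variables (n' : nat).
Let n := n'.+1.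
Variables (rep : 'I_n -> nat) (c : 'I_n -> nat -> R[i]).
Hypotheses (c_equiv : forall k, equivariant (c k))
  (c_rep : forall k j, c k (rep j) = (k == j)%:R)
  (c_expand : forall f, equivariant f ->
     forall a, f a = \sum_k f (rep k) * c k a).

Definition ext (v : 'rV[R[i]]_n) (a : nat) : R[i] := \sum_k v 0 k * c k a.

Lemma ext_rep v j : ext v (rep j) = v 0 j.
Proof.
rewrite /ext (bigD1 j) //= c_rep eqxx mulr1 big1 ?addr0 // => k kj.
by rewrite c_rep (negbTE kj) mulr0.
Qed.

Lemma ext_equivariant v : equivariant (ext v).
Proof.
split=> [a b ab|a]; first by apply: eq_bigr => k _; rewrite (proj1 (c_equiv k) _ _ ab).
by rewrite mulr_sumr; apply: eq_bigr => k _; rewrite (proj2 (c_equiv k)) mulrCA.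
Qed.

Lemma eq_equivariant f g : equivariant f -> equivariant g ->
  (forall j, f (rep j) = g (rep j)) -> f =1 g.
Proof.
move=> Ef Eg fg a; rewrite (c_expand Ef) (c_expand Eg).
by apply: eq_bigr => k _; rewrite fg.
Qed.

(* On row vectors v, identified with equivariant functions through [ext], this
   is the operator f |-> [gcd(a, N) = d] f(a u); see [ext_twist]. *)
Definition twist (d u : nat) : 'M[R[i]]_n :=
  \matrix_(k, j) ((gcdn (rep j) N == d)%:R * c k (rep j * u)).

Lemma gcd_equivariant a : gcdn (h * a) N = gcdn a N.
Proof. by rewrite mulnC gcdn_mul_unit // (coprime_dvdr _ coph) // dvdn_div // dvdn_gcdr. Qed.

Lemma gcd_periodic a b : a = b %[mod N] -> gcdn a N = gcdn b N.
Proof. by move=> ab; rewrite -gcdn_modl ab gcdn_modl. Qed.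

Lemma twisted_equivariant (d u : nat) f : equivariant f ->
  equivariant (fun a => (gcdn a N == d)%:R * f (a * u)%N).
Proof.
move=> [fp fh]; split=> [a b ab|a].
  by rewrite (gcd_periodic ab) (fp (a * u)%N (b * u)%N) // -modnMml ab modnMml.
by rewrite gcd_equivariant -mulnA fh mulrCA.
Qed.

Lemma ext_twist v d u a :
  ext (v *m twist d u) a = (gcdn a N == d)%:R * ext v (a * u).
Proof.
move: a; apply: eq_equivariant; first exact: ext_equivariant.
  by apply: twisted_equivariant; apply: ext_equivariant.
move=> j; rewrite ext_rep mxE mulr_sumr; apply: eq_bigr => k _.
by rewrite mxE mulrCA.
Qed.

Lemma eq_mx_ext (A B : 'M[R[i]]_n) :
  (forall v, ext (v *m A) =1 ext (v *m B)) -> A = B.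
Proof.
move=> AB; apply/row_matrixP=> i; rewrite !rowE; apply/rowP=> j.
by rewrite -!ext_rep AB.
Qed.

(** Multiplication by [u'] keeps the class of gcd [d'], so the two indicators either agree or
    exclude each other. In particular all twists commute. *)
Lemma twist_mul d u d' u' : coprime u' (N %/ d') ->
  twist d u *m twist d' u' = if d == d' then twist d (u * u') else 0.
Proof.
move=> cop; apply: eq_mx_ext => v a; rewrite mulmxA !ext_twist.
have E0 : ext (v *m 0) a = 0.
  by rewrite mulmx0 /ext big1 // => k _; rewrite mxE mul0r.
have [ga|ga] := eqVneq (gcdn a N) d'; last first.
  rewrite mul0r; case: ifP => // /eqP->.
  by rewrite ext_twist (negbTE ga) mul0r.
rewrite mul1r gcdn_mul_unit ?ga // [d == _]eq_sym.
case: eqVneq => [<-|_]; last by rewrite mul0r E0.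
by rewrite ext_twist ga eqxx -mulnA (mulnC u').
Qed.

Lemma twist_periodic d u v : (d %| N)%N -> u = v %[mod N %/ d] ->
  twist d u = twist d v.
Proof.
move=> dN uv; apply/matrixP=> k j; rewrite !mxE.
case: eqVneq => [gj|]; last by rewrite !mul0r.
rewrite (proj1 (c_equiv k) (rep j * u)%N (rep j * v)%N) //.
by apply: (@eqmod_mul_dvd _ d) => //; rewrite -gj dvdn_gcdl.
Qed.

(** The exponent is positive because the zeroth power is the identity, whereas [twist d 1] is the
    projection to the class of gcd [d]. *)
Lemma twist_exp d u m : coprime u (N %/ d) ->
  twist d u ^+ m.+1 = twist d (u ^ m.+1)%N.
Proof.
move=> cop; elim: m => [|m IHm]; first by rewrite expr1 expn1.
by rewrite exprSr IHm -[_ * _]/(_ *m _) twist_mul // eqxx [in RHS]expnSr.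
Qed.

Hypothesis prim_root : forall m, (0 < m)%N -> exists z : R[i], m.-primitive_root z.

(** By Euler's theorem the twist is a root of X (X^m - 1) with m the totient of N/d, which splits
    with simple roots; the root 0 accounts for the other classes. *)
Lemma twist_diagonalizable d u : (d %| N)%N -> coprime u (N %/ d) ->
  diagonalizable (twist d u).
Proof.
move=> dN cop; have M0 : (0 < N %/ d)%N by exact: divisor_quo_gt0.
have m0 : (0 < totient (N %/ d))%N by rewrite totient_gt0.
set m := totient _ in m0; have [z zP] := prim_root m0.
apply/diagonalizableP; exists (0 :: [seq z ^+ i | i <- index_iota 0 m]).
  rewrite /= map_inj_in_uniq ?iota_uniq ?andbT.
    apply/mapP=> -[i _ /esym/eqP]; rewrite expf_eq0 => /andP[_ /eqP z0].
    by have := prim_expr_order zP; rewrite z0 expr0n gtn_eqF // => /esym/eqP; rewrite oner_eq0.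
  move=> i j; rewrite !mem_index_iota /= => im jm /eqP.
  by rewrite (eq_prim_root_expr zP) !modn_small // => /eqP.
rewrite big_cons big_map factor_Xn_sub_1 // subr0.
apply: mxminpoly_min; rewrite rmorphM rmorphB /= rmorph1 horner_mx_X rmorphXn /= horner_mx_X.
rewrite mulrBr mulr1 -exprS twist_exp // (twist_periodic (v := u)) ?subrr //.
by rewrite expnS -modnMmr Euler_exp_totient // modnMmr muln1.
Qed.

Lemma twist_codiagonalizable : exists2 P : 'M[R[i]]_n, P \in unitmx &
  exists D : nat -> nat -> 'rV[R[i]]_n, forall d u, (d %| N)%N ->
    coprime u (N %/ d) -> P *m twist d u = diag_mx (D d u) *m P.
Proof.
set As := [seq twist d u | d <- divisors N,
             u <- [seq u <- iota 0 N | coprime u (N %/ d)]].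
have AsP A : A \in As -> exists d u,
    [/\ (d %| N)%N, coprime u (N %/ d) & A = twist d u].
  move=> /allpairsPdep[d [u []]]; rewrite -dvdn_divisors // => dN.
  by rewrite mem_filter => /andP[cop _] ->; exists d, u.
have : codiagonalizable As.
  apply/codiagonalizableP; split=> [A B|A].
    move=> /AsP[d [u [dN cu ->]]] /AsP[d' [u' [dN' cu' ->]]].
    rewrite /comm_mx !twist_mul // mulnC eq_sym.
    by case: eqP => // ->.
  by move=> /AsP[d [u [dN cu ->]]]; apply: twist_diagonalizable.
move=> [P uP /allP Pd]; exists P => //.
(* Codiagonalization concerns the finite list [As]; reducing [u] modulo [N %/ d] brings every twist
   into it. *)
exists (fun d u => \row_i (conjmx P (twist d (u %% (N %/ d)))) i i) => d u dN cu.
have M0 : (0 < N %/ d)%N by exact: divisor_quo_gt0.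
rewrite -(@twist_periodic d (u %% (N %/ d))) ?modn_mod //.
set A := twist _ _; have : A \in As.
  apply/allpairsPdep; exists d, (u %% (N %/ d))%N; split=> //.
    by rewrite -dvdn_divisors.
  rewrite mem_filter coprime_modl cu mem_iota /= add0n.
  by rewrite (leq_trans (ltn_pmod _ M0)) // leq_div.
move/Pd => /= /is_diag_mxP dA.
have -> : diag_mx (\row_i conjmx P A i i) = conjmx P A.
  apply/matrixP=> i j; rewrite [LHS]mxE mxE; case: eqVneq => [->|ij]; rewrite ?mulr1n //.
  by rewrite [RHS]dA ?mulr0n. 
by rewrite conjumx // -[RHS]mulmxA mulVmx ?mulmx1. 
Qed.

Lemma ext_scale a v : ext (a *: v) =1 (fun b => a * ext v b).
Proof.
by move=> b; rewrite /ext mulr_sumr; apply: eq_bigr => k _; rewrite mxE mulrA.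
Qed.

Definition eigenfunction (d : nat) (f : nat -> R[i]) (lam : nat -> R[i]) : Prop :=
  [/\ forall a, gcdn a N != d -> f a = 0,
      forall a u, gcdn a N = d -> coprime u (N %/ d) ->
        f (a * u)%N = lam u * f a
    & exists2 a, gcdn a N = d & f a != 0].

(** The projections [twist d 1] are among the diagonalized operators, which forces each basis
    function into a single class. The last clause is completeness: a simultaneous eigenvector has a
    nonzero coordinate on some basis vector, which then has the same level and eigenvalues. *)
Lemma eigenbasis : exists2 P : 'M[R[i]]_n, P \in unitmx &
  exists (lv : 'I_n -> nat) (lam : 'I_n -> nat -> R[i]),
  (forall i, (lv i %| N)%N /\ eigenfunction (lv i) (ext (row i P)) (lam i)) /\
  forall d (v : 'rV_n) (chi : nat -> R[i]), (d %| N)%N -> v != 0 -> chi 1%N = 1 ->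
    (forall u, coprime u (N %/ d) -> v *m twist d u = chi u *: v) ->
    exists2 i, lv i = d & forall u, coprime u (N %/ d) -> lam i u = chi u.
Proof.
have [P uP [D PD]] := twist_codiagonalizable.
exists P => //.
(* The default 1 is never reached, since a row of an invertible matrix is nonzero. *)
pose lv i := if [pick j | P i j != 0] is Some j then gcdn (rep j) N else 1%N.
have lvP i : exists2 j, gcdn (rep j) N = lv i & ext (row i P) (rep j) != 0.
  rewrite /lv; case: pickP => [j Pij|Pi0]; first by exists j; rewrite ?ext_rep ?mxE.
  have : row i P *m invmx P = 0.
    suff -> : row i P = 0 by rewrite mul0mx.
    by apply/rowP=> j; move/negbT/negPn/eqP: (Pi0 j); rewrite !mxE.
  rewrite -row_mul mulmxV // row1 => /rowP/(_ i)/eqP.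
  by rewrite !mxE !eqxx oner_eq0.
have lvN i : (lv i %| N)%N by have [j <- _] := lvP i; apply: dvdn_gcdr.
have PDi i d u a : (d %| N)%N -> coprime u (N %/ d) ->
    (gcdn a N == d)%:R * ext (row i P) (a * u) = D d u 0 i * ext (row i P) a.
  move=> dN cu; rewrite -ext_twist -row_mul PD // row_mul row_diag_mx -scalemxAl -rowE.
  by rewrite ext_scale.
exists lv, (fun i u => D (lv i) u 0 i); split=> [i|d v chi dN v0 chi1 vchi].
  split=> //; have [j jlv fj] := lvP i; split; last by exists (rep j).
    (* At [rep j] the relation for u = 1 forces the eigenvalue of the projection to be 1; off the
       class it then says that the function is 0. *)
    have := PDi i _ 1%N (rep j) (lvN i) (coprime1n _).
    rewrite jlv eqxx mul1r muln1 -[LHS]mul1r => /(mulIf fj) D1 a /negbTE ga.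
    by have := PDi i _ 1%N a (lvN i) (coprime1n _); rewrite ga mul0r -D1 mul1r.
  by move=> a u ga cu; rewrite -(PDi i _ u a (lvN i) cu) ga eqxx mul1r.
pose w := v *m invmx P.
have vw : v = w *m P by rewrite -mulmxA mulVmx ?mulmx1.
have wD u i : coprime u (N %/ d) -> w 0 i * D d u 0 i = chi u * w 0 i.
  move=> cu; suff /rowP/(_ i) : w *m diag_mx (D d u) = chi u *: w.
    by rewrite mul_mx_diag !mxE.
  apply: (can_inj (mulmxK uP)).
  by rewrite -mulmxA -PD // mulmxA -vw vchi // -scalemxAl -vw.
have [i wi|w0] := pickP (fun i => w 0 i != 0); last first.
  case/eqP: v0; rewrite vw; suff -> : w = 0 by rewrite mul0mx.
  by apply/rowP=> i; move: (w0 i) => /negbT/negPn/eqP ->; rewrite mxE.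
have Dchi u : coprime u (N %/ d) -> D d u 0 i = chi u.
  by move=> /(wD _ i); rewrite mulrC => /(mulIf wi).
have lvd : lv i = d.
  have [j <- fj] := lvP i.
  have := PDi i _ 1%N (rep j) dN (coprime1n _).
  rewrite Dchi ?coprime1n // chi1 muln1; case: eqVneq => // _ /eqP.
  by rewrite mul0r mul1r eq_sym (negbTE fj).
by exists i => // u cu; rewrite lvd Dchi.
Qed.

(** * Eigenvalues of the twists as characters of the units modulo N/d *)

(** The Dirichlet character attached to [chi]: its periodic extension, by 0 off the units. *)
Definition char_ext (M : nat) (chi : {ffun zunit M -> R[i]}) (u : nat) : R[i] :=
  \sum_(t : zunit M) (zval t == (u %% M)%N)%:R * chi t.

Lemma char_extE M (chi : {ffun zunit M -> R[i]}) u t :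
  zval t = (u %% M)%N -> char_ext chi u = chi t.
Proof.
move=> tu; rewrite /char_ext (bigD1 t) //= tu eqxx mul1r big1 ?addr0 // => s st.
case: eqVneq => [su|]; last by rewrite mul0r.
by case/eqP: st; apply: zval_inj; rewrite su.
Qed.

Section Eigenfunction.

Variables (d : nat) (f : nat -> R[i]) (lam : nat -> R[i]).
Hypotheses (dN : (d %| N)%N) (fE : equivariant f) (fP : eigenfunction d f lam).

Let M := (N %/ d)%N.
Let M0 : (0 < M)%N := divisor_quo_gt0 N0 dN.

(** Evaluation at a point where [f] is nonzero turns relations between the arguments [a * u] into
    relations between eigenvalues. The next lemmas use the same device. *)
Lemma eigenvalue_mod u v : coprime u M -> u = v %[mod M] -> lam u = lam v.
Proof.
have [_ fl [a ga fa]] := fP; move=> cu uv; apply: (mulIf fa).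
have cv : coprime v M by rewrite -coprime_modl -uv coprime_modl.
rewrite -!fl //; apply: (proj1 fE).
by apply: (@eqmod_mul_dvd _ d) => //; rewrite -ga dvdn_gcdl.
Qed.

Lemma eigenvalue_mul u v : coprime u M -> coprime v M ->
  lam (u * v)%N = lam u * lam v.
Proof.
have [_ fl [a ga fa]] := fP; move=> cu cv; apply: (mulIf fa).
rewrite -fl ?coprimeMl ?cu // mulnA fl //; last by rewrite gcdn_mul_unit ?ga.
by rewrite fl // mulrCA mulrA.
Qed.

Lemma eigenvalue1 : lam 1%N = 1.
Proof.
have [_ fl [a ga fa]] := fP; apply: (mulIf fa).
by rewrite -fl ?coprime1n // muln1 mul1r.
Qed.

Lemma eigenvalue_equivariant : lam h = eps.
Proof.
have [_ fl [a ga fa]] := fP; apply: (mulIf fa).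
by rewrite -fl ?(coprime_dvdr _ coph) ?dvdn_div // mulnC (proj2 fE).
Qed.

Lemma eigenvalue_character : @equivariant_characters M [ffun t => lam (zval t)].
Proof.
have coh : coprime h M by rewrite (coprime_dvdr _ coph) ?dvdn_div.
split=> [|e eh]; last first.
  by rewrite ffunE (eigenvalue_mod (zval_coprime e) eh) eigenvalue_equivariant.
split=> [s|e e1|s t u ust]; rewrite !ffunE.
- have [v cv sv] := coprime_expn_inv M0 (zval_coprime s).
  apply/eqP=> ls0; have := eigenvalue_mul (zval_coprime s) cv.
  rewrite ls0 mul0r (eigenvalue_mod _ sv) ?eigenvalue1.
    by move/eqP; rewrite oner_eq0.
  by rewrite coprimeMl zval_coprime.
- by rewrite (eigenvalue_mod (zval_coprime e) e1) eigenvalue1.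
- by rewrite (eigenvalue_mod (zval_coprime u) ust) eigenvalue_mul ?zval_coprime.
Qed.

Lemma char_ext_eigenvalue u : coprime u M ->
  char_ext [ffun t : zunit M => lam (zval t)] u = lam u.
Proof.
move=> cu; have [t tu] := zunit_exists M0 cu.
rewrite (char_extE _ tu) ffunE; apply: eigenvalue_mod; first exact: zval_coprime.
by rewrite tu modn_mod.
Qed.

End Eigenfunction.
Lemma char_ext_mod M (chi : {ffun zunit M -> R[i]}) u v :
  u = v %[mod M] -> char_ext chi u = char_ext chi v.
Proof. by rewrite /char_ext => ->. Qed.

Lemma char_ext_mul M (chi : {ffun zunit M -> R[i]}) u v : (0 < M)%N ->
    is_character chi -> coprime u M -> coprime v M ->
  char_ext chi (u * v) = char_ext chi u * char_ext chi v.
Proof.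
move=> M0 [_ _ chiM] cu cv.
have [s su] := zunit_exists M0 cu; have [t tv] := zunit_exists M0 cv.
have cuv : coprime (u * v) M by rewrite coprimeMl cu.
have [r ruv] := zunit_exists M0 cuv.
rewrite (char_extE _ su) (char_extE _ tv) (char_extE _ ruv); apply: chiM.
by rewrite ruv su tv modn_mod modnMm.
Qed.

Lemma char_ext1 M (chi : {ffun zunit M -> R[i]}) : (0 < M)%N ->
  is_character chi -> char_ext chi 1 = 1.
Proof.
move=> M0 [_ chi1 _]; have [t t1] := zunit_exists M0 (coprime1n M).
by rewrite (char_extE _ t1) chi1 // t1 modn_mod.
Qed.

Lemma char_ext_equivariant M (chi : {ffun zunit M -> R[i]}) : (0 < M)%N ->
  equivariant_characters chi -> coprime h M -> char_ext chi h = eps.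
Proof.
move=> M0 [_ chih] coh; have [t th] := zunit_exists M0 coh.
by rewrite (char_extE _ th) chih // th modn_mod.
Qed.

Lemma character_eigenfunction d (chi : {ffun zunit (N %/ d) -> R[i]}) :
    (d %| N)%N -> equivariant_characters chi ->
  exists2 f, equivariant f & eigenfunction d f (char_ext chi).
Proof.
move=> dN chiP; have M0 := divisor_quo_gt0 N0 dN; have [chiC _] := chiP.
have d0 := dvdn_gt0 N0 dN.
have coh : coprime h (N %/ d) by rewrite (coprime_dvdr _ coph) ?dvdn_div.
(* On the class of gcd [d], division by [d] identifies residues modulo N with units modulo N/d,
   along which [chi] is transported. *)
pose f a := (gcdn a N == d)%:R * char_ext chi (a %/ d).
have fl a u : gcdn a N = d -> coprime u (N %/ d) -> f (a * u)%N = char_ext chi u * f a.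
  move=> ga cu; rewrite /f gcdn_mul_unit ?ga // eqxx !mul1r.
  have da : (d %| a)%N by rewrite -ga dvdn_gcdl.
  rewrite -divn_mulAC // mulnC char_ext_mul //.
  by rewrite /coprime -(eqn_pmul2r d0) muln_gcdl !divnK // ga mul1n.
exists f.
split=> [a b ab|a].
- rewrite /f (gcd_periodic ab); case: eqVneq => [gb|]; last by rewrite !mul0r.
  congr (_ * _); apply: char_ext_mod; apply/eqP.
  have da : (d %| a)%N by rewrite -gb -(gcd_periodic ab) dvdn_gcdl.
  have db : (d %| b)%N by rewrite -gb dvdn_gcdl.
  by rewrite -(eqn_pmul2r d0) !muln_modl !divnK // ab.
- have [ga|ga] := eqVneq (gcdn a N) d.
    by rewrite mulnC fl // char_ext_equivariant.
  by rewrite /f gcd_equivariant (negbTE ga) !mul0r mulr0.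
split=> [a /negbTE ga|a u ga cu|]; first by rewrite /f ga mul0r.
  exact: fl.
exists d; first exact/gcdn_idPl.
by rewrite /f (gcdn_idPl dN) eqxx mul1r divnn d0 char_ext1 ?oner_eq0.
Qed.

Lemma proportional_rows (P : 'M[R[i]]_n) i j a : P \in unitmx ->
  row i P = a *: row j P -> i = j.
Proof.
move=> uP; case: (eqVneq i j) => // ij /(congr1 (mulmx^~ (invmx P))).
rewrite -scalemxAl -!row_mul mulmxV // !row1 => /rowP/(_ i)/eqP.
by rewrite !mxE !eqxx (negbTE ij) mulr0 oner_eq0.
Qed.

Lemma coprime_div_gcd a : coprime (a %/ gcdn a N) (N %/ gcdn a N).
Proof.
have d0 : (0 < gcdn a N)%N by rewrite gcdn_gt0 N0 orbT.
by rewrite /coprime -(eqn_pmul2r d0) muln_gcdl !divnK ?dvdn_gcdl ?dvdn_gcdr // mul1n.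
Qed.

(** The unit is the quotient of b/d by a/d modulo N/d. Since the class is a single orbit, an
    eigenfunction is determined up to a scalar by its level and its character. *)
Lemma gcd_orbit d a b : gcdn a N = d -> gcdn b N = d ->
  exists2 u, coprime u (N %/ d) & b = a * u %[mod N].
Proof.
move=> ga gb; have dN : (d %| N)%N by rewrite -ga dvdn_gcdr.
have da : (d %| a)%N by rewrite -ga dvdn_gcdl.
have db : (d %| b)%N by rewrite -gb dvdn_gcdl.
have ca := coprime_div_gcd a; have cb := coprime_div_gcd b; rewrite ga gb in ca cb.
have [v cv av] := coprime_expn_inv (divisor_quo_gt0 N0 dN) ca.
exists (b %/ d * v)%N; first by rewrite coprimeMl cb.
rewrite -[in RHS](divnK da) mulnAC mulnA -[in LHS](divnK db) -2!(mulnC d).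
apply: (@eqmod_mul_dvd _ d) => //.
by rewrite mulnAC mulnC -modnMmr av modnMmr muln1.
Qed.

Lemma eigenfunction_neq0 d f lam a : equivariant f -> eigenfunction d f lam ->
  gcdn a N = d -> f a != 0.
Proof.
move=> [fN _] [_ fl [b gb fb]] ga; have [u cu bau] := gcd_orbit ga gb.
by move: fb; rewrite (fN _ _ bau) fl // mulf_eq0 negb_or => /andP[].
Qed.

Lemma eigenfunction_proportional d f g lam mu :
    equivariant f -> equivariant g ->
    eigenfunction d f lam -> eigenfunction d g mu ->
    (forall u, coprime u (N %/ d) -> lam u = mu u) ->
  exists a, forall b, f b = a * g b.
Proof.
move=> fE gE fP gP lm; have [f0 fl [a ga fa]] := fP; have [g0 gl _] := gP.
have ga0 := eigenfunction_neq0 gE gP ga.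
exists (f a / g a) => b; have [gb|gb] := eqVneq (gcdn b N) d; last first.
  by rewrite (f0 b) // (g0 b) // mulr0.
have [u cu bau] := gcd_orbit ga gb.
by rewrite (proj1 fE _ _ bau) (proj1 gE _ _ bau) fl // gl // lm // mulrCA mulfVK.
Qed.

(* i |-> (lv i, lam i) is a bijection onto the pairs (d, chi): two basis vectors
   with the same image would be proportional, and the eigenfunction extending any
   chi has a nonzero coordinate on some basis vector. *)
Lemma prod_eigenbasis (P : 'M[R[i]]_n) (lv : 'I_n -> nat)
    (lam : 'I_n -> nat -> R[i]) (T : comNzRingType)
    (F : forall d, {ffun zunit (N %/ d) -> R[i]} -> T) : P \in unitmx ->
    (forall i, (lv i %| N)%N /\ eigenfunction (lv i) (ext (row i P)) (lam i)) ->
    (forall d (v : 'rV_n) (chi : nat -> R[i]), (d %| N)%N -> v != 0 -> chi 1%N = 1 ->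
      (forall u, coprime u (N %/ d) -> v *m twist d u = chi u *: v) ->
      exists2 i, lv i = d & forall u, coprime u (N %/ d) -> lam i u = chi u) ->
  \prod_i F (lv i) [ffun t => lam i (zval t)] =
  \prod_(d <- divisors N)
    \big[*%R/1]_(chi \in @equivariant_characters (N %/ d)) F d chi.
Proof.
move=> uP lvP lvS.
transitivity (\prod_i \prod_(d <- divisors N | d == lv i) F d [ffun t => lam i (zval t)]).
  apply: eq_bigr => i _; rewrite -big_filter filter_pred1_uniq ?divisors_uniq ?big_seq1 //.
  by rewrite -dvdn_divisors //; case: (lvP i).
rewrite (exchange_big_dep predT) //=; rewrite !big_seq; apply: eq_bigr => d.
rewrite -dvdn_divisors // => dN.
pose chi i : {ffun zunit (N %/ d) -> R[i]} := [ffun t => lam i (zval t)].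
have M0 := divisor_quo_gt0 N0 dN.
have eE i : equivariant (ext (row i P)) := ext_equivariant (row i P).
have chi_lam i u : lv i = d -> coprime u (N %/ d) -> char_ext (chi i) u = lam i u.
  move=> di; have Pi := proj2 (lvP i); rewrite di in Pi.
  exact: char_ext_eigenvalue dN (eE i) Pi _.
have lam_ext i j : lv i = d -> lv j = d -> chi i = chi j -> i = j.
  move=> di dj ij; have [_ Pi] := lvP i; have [_ Pj] := lvP j.
  rewrite di in Pi; rewrite dj in Pj.
  have [u cu|a fa] := eigenfunction_proportional (eE i) (eE j) Pi Pj.
    by rewrite -!chi_lam // ij.
  apply: (proportional_rows (a := a) uP); apply/rowP=> k.
  by rewrite [RHS]mxE -!ext_rep fa.
rewrite (eq_bigl (fun i => lv i == d)) => [|i]; last by rewrite eq_sym.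
rewrite -big_filter.
rewrite -(big_map chi xpredT (F d)) fsbig_seq.
  congr (\big[_/_]_(_ \in _) _); apply/seteqP; split=> [x' x'P|x xP].
    have [k] := @mapP _ {ffun zunit (N %/ d) -> R[i]} chi _ _ x'P.
    rewrite mem_filter => /andP[/eqP dk _] ->.
    have Pk := proj2 (lvP k); rewrite dk in Pk.
    exact: eigenvalue_character dN (eE k) Pk.
  have [f fE fP] := character_eigenfunction dN xP; have [xC _] := xP.
  pose v : 'rV[R[i]]_n := \row_j f (rep j).
  have vf : ext v =1 f.
    by apply: eq_equivariant (ext_equivariant v) fE _ => j; rewrite ext_rep mxE.
  have v0 : v != 0.
    have [_ _ [a _ fa]] := fP; apply: contraNneq fa => v0.
    by rewrite -vf v0 /ext big1 // => k _; rewrite mxE mul0r.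
  have [|u cu|i di lamx] := lvS d v (char_ext x) dN v0.
  - exact: char_ext1.
  - apply/rowP=> j; rewrite -!ext_rep ext_twist ext_scale !vf.
    have [f0 fl _] := fP; case: eqVneq => [gj|gj]; first by rewrite mul1r fl.
    by rewrite mul0r f0 // mulr0.
  apply/mapP; exists i; first by rewrite mem_filter di eqxx mem_index_enum.
  apply/ffunP=> t; rewrite ffunE lamx ?zval_coprime //.
  by rewrite (@char_extE _ x _ t) ?modn_small ?zval_lt.
rewrite map_inj_in_uniq ?filter_uniq ?index_enum_uniq // => i j.
rewrite !mem_filter => /andP[/eqP di _] /andP[/eqP dj _]; exact: lam_ext.
Qed.

(** * Determinant of the operator A *)

Definition convolution_mx (L : comAlgType R[i]) (x : nat -> L) : 'M[L]_n :=
  \matrix_(k, j) \sum_(s < N) c k (rep j * s)%N *: x s.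

(** Entry (i, j) of P A is the sum over s of f_i(rep j * s) x_s. As gcd(rep j, N) divides gcd(rep j
    * s, N), it vanishes when the level of f_i is smaller than gcd(rep j, N). When the two are
    equal, only the s prime to N/d survive and f_i(rep j) factors out, leaving the character sum;
    [det_scaled_leibniz] applies. *)
Lemma det_convolution (L : comAlgType R[i]) (x : nat -> L) (X : nat -> nat -> L) :
    (forall d t, (d %| N)%N ->
       \sum_(s < N | s == t %[mod N %/ d]) x s = d%:R * X d t) ->
  \det (convolution_mx x) =
  \prod_(d <- divisors N)
    \big[*%R/1]_(chi \in @equivariant_characters (N %/ d))
      (d%:R * \sum_(t : zunit (N %/ d)) chi t *: X d (zval t)).
Proof.
move=> xX; have [P uP [lv [lam [lvP lvS]]]] := eigenbasis.
pose F d (chi : {ffun zunit (N %/ d) -> R[i]}) :=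
  d%:R * \sum_(t : zunit (N %/ d)) chi t *: X d (zval t).
rewrite -(prod_eigenbasis F uP lvP lvS).
pose f i := ext (row i P); have fE i : equivariant (f i) := ext_equivariant _.
(* The s prime to [N %/ lv i] are grouped by residue, on which alone [lam i] depends; [xX] evaluates
   the sum of [x] over each group. *)
have FE i : F (lv i) [ffun t => lam i (zval t)] =
    \sum_(s < N | coprime s (N %/ lv i)) lam i s *: x s.
  have [dN Pi] := lvP i; rewrite /F mulr_sumr.
  under eq_bigr => t _ do rewrite -scalerAr -xX // scaler_sumr.
  rewrite (exchange_big_dep (fun s : 'I_N => coprime s (N %/ lv i))) /=.
    apply: eq_bigr => s cs; have [t ts] := zunit_exists (divisor_quo_gt0 N0 dN) cs.
    rewrite (big_pred1 t) => [|t'].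
      rewrite ffunE (eigenvalue_mod dN (fE i) Pi (zval_coprime t) (v := s)) //.
      by rewrite ts modn_mod.
    rewrite eq_sym (modn_small (zval_lt t')) -ts.
    by apply/eqP/eqP=> [/zval_inj|->].
  by move=> t s _ /eqP st; rewrite -coprime_modl st coprime_modl zval_coprime.
pose PL := map_mx (in_alg L) P.
(* In [L], the factor [\det P] is cancelled through its inverse in the base field. *)
have detPL : \det PL * in_alg L (\det P)^-1 = 1.
  by rewrite det_map_mx -rmorphM mulfV ?rmorph1 // -unitfE -unitmxE.
have PB i j : (PL *m convolution_mx x) i j = \sum_(s < N) f i (rep j * s)%N *: x s.
  rewrite mxE; under eq_bigr => k _ do rewrite !mxE mulr_sumr.
  rewrite exchange_big; apply: eq_bigr => s _; rewrite /f /ext scaler_suml.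
  by apply: eq_bigr => k _; rewrite mxE -scalerA in_algE mulr_algl.
suff : \det (PL *m convolution_mx x) = (\prod_i F (lv i) [ffun t => lam i (zval t)]) * \det PL.
  rewrite det_mulmx mulrC => /(congr1 ( *%R^~ (in_alg L (\det P)^-1))).
  by rewrite -!mulrA detPL !mulr1.
apply: (@det_scaled_leibniz _ _ _ _ _ lv (fun j => gcdn (rep j) N)) => [i j lt|i j ne|i j eq|].
- rewrite PB big1 // => s _; have [f0 _ _] := proj2 (lvP i).
  rewrite /f f0 ?scale0r //; apply: contraTneq lt => <-; rewrite -leqNgt.
  rewrite dvdn_leq ?gcdn_gt0 ?N0 ?orbT // dvdn_gcd dvdn_gcdr andbT.
  by rewrite dvdn_mulr // dvdn_gcdl.
- have [f0 _ _] := proj2 (lvP i).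
  have Pij : P i j = ext (row i P) (rep j) by rewrite ext_rep mxE.
  by rewrite mxE Pij f0 // rmorph0.
- have [f0 fl _] := proj2 (lvP i).
  rewrite PB FE mulr_suml [RHS]big_mkcond; apply: eq_bigr => s _.
  have [cs|ncs] := boolP (coprime s _).
    rewrite /f fl // -scalerA -scalerAl; congr (_ *: _).
    by rewrite ext_rep [in RHS]mxE mulrC mulr_algl mxE.
  rewrite /f f0 ?scale0r //; apply: contraNneq ncs => gs; rewrite -eq.
  by apply: gcdn_mul_eq => //; rewrite gs eq.
apply: contraTneq isT => detPL0; move/eqP: detPL.
by rewrite detPL0 mul0r eq_sym oner_eq0.
Qed.

(** The function a |-> kappa(rep i * a) is equivariant, so its value at rep j * s expands in the
    basis [c] with coefficients kappa(rep i * rep k). This is the factorization of the matrix into K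
    and A. *)
Lemma det_equivariant (L : comAlgType R[i]) (x : nat -> L) (X : nat -> nat -> L)
    (y : nat -> L) (kappa : nat -> R[i]) (alpha : R[i]) : equivariant kappa ->
    (forall d t, (d %| N)%N ->
       \sum_(s < N | s == t %[mod N %/ d]) x s = d%:R * X d t) ->
    (forall a, y a = alpha *: \sum_(s < N) kappa (a * s)%N *: x s) ->
  \det (\matrix_(i, j) y (rep i * rep j)%N) =
  (alpha ^+ n * \det (\matrix_(i < n, k < n) kappa (rep i * rep k)%N)) *:
  \prod_(d <- divisors N)
    \big[*%R/1]_(chi \in @equivariant_characters (N %/ d))
      (d%:R * \sum_(t : zunit (N %/ d)) chi t *: X d (zval t)).
Proof.
move=> [kN kh] xX yE; rewrite -(det_convolution xX).
set K := \matrix_(i < n, k < n) kappa (rep i * rep k)%N.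
have -> : \matrix_(i, j) y (rep i * rep j)%N =
    map_mx (in_alg L) (alpha *: K) *m convolution_mx x.
  apply/matrixP=> i j; rewrite !mxE yE scaler_sumr.
  have kE : equivariant (fun a => kappa (rep i * a)%N).
    split=> [a b ab|a]; first by apply: kN; rewrite -modnMmr ab modnMmr.
    by rewrite mulnCA kh.
  transitivity (\sum_(s < N) \sum_k
      alpha *: (kappa (rep i * rep k)%N *: (c k (rep j * s)%N *: x s))).
    apply: eq_bigr => s _; rewrite -mulnA (c_expand kE) scaler_suml scaler_sumr.
    by apply: eq_bigr => k _; rewrite -scalerA.
  rewrite exchange_big; apply: eq_bigr => k _.
  by rewrite !mxE mulr_algl -scaler_sumr -scaler_sumr scalerA.
by rewrite det_mulmx det_map_mx detZ mulr_algl.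
Qed.

End Equivariant.

(** * Discrete Fourier transform *)

Section RootSums.

Variables (F : fieldType) (N : nat) (w : F).
Hypothesis wP : N.-primitive_root w.

Let N0 : (0 < N)%N := prim_order_gt0 wP.

Lemma prim_root_neq0 : w != 0.
Proof.
apply/eqP=> w0; have := prim_expr_order wP.
by rewrite w0 expr0n gtn_eqF // => /esym/eqP; rewrite oner_eq0.
Qed.

Lemma sum_unity_root (z : F) m : z ^+ m = 1 ->
  \sum_(s < m) z ^+ s = (z == 1)%:R * m%:R.
Proof.
move=> zm; case: eqVneq => [->|z1].
  by rewrite mul1r (eq_bigr (fun=> 1)) ?sumr_const ?card_ord // => s _; rewrite expr1n.
have := subrX1 z m; rewrite zm subrr => /esym/eqP.
by rewrite mulf_eq0 subr_eq0 (negbTE z1) mul0r => /eqP.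
Qed.

Lemma prim_root_orthogonal a r :
  \sum_(s < N) (w ^- (a * s) * w ^+ (r * s)) = (a == r %[mod N])%:R * N%:R.
Proof.
have wa0 b : w ^+ b != 0 by rewrite expf_neq0 // prim_root_neq0.
under eq_bigr => s _ do rewrite !exprM -exprVn -exprMn.
rewrite sum_unity_root; last first.
  rewrite exprMn exprVn -!exprM ![(_ * N)%N]mulnC !exprM (prim_expr_order wP).
  by rewrite !expr1n invr1 mulr1.
congr (_%:R * _); rewrite -(inj_eq (mulfI (wa0 a))) mulVKf // mulr1.
by rewrite (eq_prim_root_expr wP) eq_sym.
Qed.

End RootSums.

Lemma big_ord_mod_class (V : nmodType) (F : nat -> V) (M d t : nat) : (0 < M)%N ->
  \sum_(s < d * M | s == t %[mod M]) F s = \sum_(u < d) F (u * M + t %% M)%N.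
Proof.
move=> M0; rewrite -!(big_mkord (fun s => s == t %[mod M])).
rewrite -(big_mkord xpredT (fun u => F (u * M + t %% M)%N)).
elim: d => [|d IHd]; first by rewrite !big_geq.
rewrite (big_cat_nat (n := d * M)) ?leq_mul //= IHd big_nat_recr //=; congr (_ + _).
rewrite mulSn -{1}[(d * M)%N]add0n big_addn addnK.
have tM : (t %% M < M)%N by rewrite ltn_mod.
rewrite big_mkord (big_pred1 (Ordinal tM)) /= ?[(d * M + _)%N]addnC // => s.
by rewrite addnC modnMDl modn_small // -val_eqE.
Qed.

Lemma big_ord_divisible (V : nmodType) (F : nat -> V) (N d : nat) :
  (0 < N)%N -> (d %| N)%N ->
  \sum_(r < N | (d %| r)%N) F r = \sum_(r < N %/ d) F (d * r)%N.
Proof.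
move=> N0 dN; have d0 := dvdn_gt0 N0 dN.
transitivity (\sum_(r < N %/ d * d | r == 0 %[mod d]) F r).
  rewrite -!(big_mkord (fun r => (d %| r)%N)) -(big_mkord (fun r => r == 0 %[mod d])).
  by rewrite divnK //; apply: eq_bigl => r; rewrite mod0n.
by rewrite big_ord_mod_class //; apply: eq_bigr => r _; rewrite mod0n addn0 mulnC.
Qed.

Section Fourier.

Variables (R : realType) (N : nat).
Hypothesis N0 : (0 < N)%N.

(* Such a kernel turns the sum of a transform over a residue class modulo N/d
   into d times the transform of the subsampled sequence (x_{dr})_r. *)
Definition sampling_kernel (k : nat -> R[i]) : Prop :=
  forall d t r, (d %| N)%N ->
    \sum_(s < N | s == t %[mod N %/ d]) k (s * r)%N
      = (d %| r)%:R * d%:R * k (t * r)%N.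

(** The class of t modulo N/d consists of the t + u N/d for u < d. Summing over u gives a geometric
    sum in a d-th root of unity, which is 1 exactly when d divides r. *)
Lemma sampling_kernel_root w : N.-primitive_root w ->
  sampling_kernel (fun a => w ^+ a).
Proof.
move=> wP d t r dN; have d0 := dvdn_gt0 N0 dN; have M0 := divisor_quo_gt0 N0 dN.
transitivity (\sum_(s < d * (N %/ d) | s == t %[mod N %/ d]) w ^+ (s * r)).
  rewrite -!(big_mkord (fun s => s == t %[mod N %/ d]) (fun s => w ^+ (s * r))).
  by rewrite mulnC divnK.
rewrite (big_ord_mod_class (fun s => w ^+ (s * r))) //.
under eq_bigr => u _ do rewrite mulnDl exprD -mulnA mulnC exprM.
rewrite -mulr_suml.
have wMP := dvdn_prim_root wP dN.
rewrite sum_unity_root; last first.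
  by rewrite -exprM mulnAC divnK // exprM (prim_expr_order wP) expr1n.
rewrite exprM -(prim_order_dvd wMP).
case: (boolP (d %| r)%N) => [dr|]; rewrite ?mul0r //; congr (_ * _).
apply/eqP; rewrite (eq_prim_root_expr wP) ![(_ * r)%N]mulnC; apply/eqP.
by apply: (@eqmod_mul_dvd _ d); rewrite ?modn_mod.
Qed.

Lemma sampling_kernelD k l : sampling_kernel k -> sampling_kernel l ->
  sampling_kernel (fun a => k a + l a).
Proof. by move=> kS lS d t r dN; rewrite big_split /= kS // lS // mulrDr. Qed.

Lemma eq_sampling_kernel k l : k =1 l -> sampling_kernel k -> sampling_kernel l.
Proof.
by move=> kl kS d t r dN; rewrite -kl -kS //; apply: eq_bigr => s _; rewrite kl.
Qed.

Lemma sampling_kernelZ a k : sampling_kernel k -> sampling_kernel (fun b => a * k b).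
Proof. by move=> kS d t r dN; rewrite -mulr_sumr kS // mulrCA. Qed.

Variables (h : nat) (eps : R[i]).

(** Fourier inversion up to symmetry: the right-hand side is the kernel of N times the projection f
    |-> (f + eps f(h .)) / 2. *)
Definition dual_kernels (k k' : nat -> R[i]) : Prop :=
  forall a r, \sum_(s < N) k (a * s)%N * k' (s * r)%N
    = N%:R / 2 * ((a == r %[mod N])%:R + eps * (h * a == r %[mod N])%:R).

Variables (L : comAlgType R[i]) (x : nat -> L) (k' : nat -> R[i]) (gam : R[i]).
Hypotheses (x_mod : forall a b, a = b %[mod N] -> x a = x b)
  (x_h : forall a, x (h * a)%N = eps *: x a) (eps2 : eps * eps = 1)
  (k'S : sampling_kernel k').

(** The sum runs over a full period. With [gam] = 1/2 it becomes the folded sums [yhat] and [zhat],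
    because r and -r contribute equally. *)
Definition transform (d t : nat) : L :=
  gam *: \sum_(r < N %/ d) k' (t * (d * r))%N *: x (d * r)%N.

(** Only the indices divisible by [d] survive summation over a class, each with weight [d]: this is
    the [d] in front of the character sums. *)
Lemma transform_class d t : (d %| N)%N ->
  \sum_(s < N | s == t %[mod N %/ d]) transform 1 s = d%:R * transform d t.
Proof.
move=> dN; rewrite /transform -scaler_sumr -scalerAr; congr (_ *: _).
rewrite exchange_big /= divn1.
under eq_bigr => r _ do rewrite -scaler_suml mul1n k'S // -mulrA.
transitivity (\sum_(r < N | (d %| r)%N) (d%:R * k' (t * r)%N) *: x r).
  rewrite [RHS]big_mkcond; apply: eq_bigr => r _.
  by case: ifP; rewrite ?mul1r // mul0r scale0r.
rewrite (big_ord_divisible (fun r => (d%:R * k' (t * r)%N) *: x r)) // mulr_sumr.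
by apply: eq_bigr => r _; rewrite -scalerA scaler_nat mulr_natl.
Qed.

Lemma sum_delta a : \sum_(r < N) (a == r %[mod N])%:R *: x r = x a.
Proof.
have aN : (a %% N < N)%N by rewrite ltn_mod.
rewrite (bigD1 (Ordinal aN)) //= modn_mod eqxx scale1r big1 ?addr0.
  by apply: x_mod; rewrite modn_mod.
move=> r ne; rewrite (modn_small (ltn_ord r)); case: eqP => [E|]; last by rewrite scale0r.
by case/eqP: ne; apply: val_inj.
Qed.

Lemma transform_inversion k alpha : dual_kernels k k' -> alpha * gam * N%:R = 1 ->
  forall a, x a = alpha *: \sum_(s < N) k (a * s)%N *: transform 1 s.
Proof.
move=> kk' agN a; rewrite /transform.
transitivity ((alpha * gam) *: \sum_(r < N) (\sum_(s < N) k (a * s)%N * k' (s * r)%N) *: x r).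
  under eq_bigr => r _ do rewrite kk' -scalerA scalerDl -scalerA.
  rewrite -scaler_sumr big_split /= sum_delta -scaler_sumr sum_delta x_h !scalerA.
  have xx : x a + x a = (2 : R[i]) *: x a by rewrite scaler_nat mulr2n.
  rewrite eps2 scale1r xx scalerA.
  by rewrite -mulrA divfK ?pnatr_eq0 // agN scale1r.
rewrite -scalerA; congr (_ *: _); rewrite scaler_sumr.
under eq_bigr => r _ do rewrite scaler_suml scaler_sumr.
rewrite exchange_big; apply: eq_bigr => s _.
rewrite divn1 !scaler_sumr; apply: eq_bigr => r _.
by rewrite mul1n !scalerA mulrCA mulrA.
Qed.

End Fourier.

(** * Trigonometric kernels *)

Section Trigonometry.

Variable R : realType.

Definition cis (x : R) : R[i] := cos x +i* sin x.

Lemma cis0 : cis 0 = 1.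
Proof. by rewrite /cis cos0 sin0. Qed.

Lemma cisD x y : cis (x + y) = cis x * cis y.
Proof.
by apply/eqP; rewrite eq_complex /= cosD sinD; apply/andP; split; apply/eqP; ring.
Qed.

Lemma cis_neq0 x : cis x != 0.
Proof.
apply/eqP=> c0; have := cisD x (- x).
by rewrite c0 mul0r subrr cis0 => /eqP; rewrite oner_eq0.
Qed.

Lemma cisN x : cis (- x) = (cis x)^-1.
Proof.
by apply: (mulIf (cis_neq0 x)); rewrite -cisD addNr cis0 mulVf ?cis_neq0.
Qed.

Lemma cisX x n : cis x ^+ n = cis (x * n%:R).
Proof.
elim: n => [|n IHn]; first by rewrite mulr0 cis0 expr0.
by rewrite exprSr IHn -cisD -natr1 mulrDr mulr1.
Qed.

Lemma cos_cis x : (cos x)%:C = 2^-1 * (cis x + (cis x)^-1).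
Proof.
rewrite -cisN /cis cosN sinN; apply: (@mulfI _ 2); first by rewrite pnatr_eq0.
rewrite mulVKf ?pnatr_eq0 //; apply/eqP; rewrite eq_complex /=.
by apply/andP; split; apply/eqP; ring.
Qed.

Lemma sin_cis x : (sin x)%:C = (- 'i%C / 2) * (cis x - (cis x)^-1).
Proof.
rewrite -cisN /cis cosN sinN; apply: (@mulfI _ 2); first by rewrite pnatr_eq0.
rewrite mulrA mulrCA mulfV ?pnatr_eq0 // mulr1; apply/eqP; rewrite eq_complex /=.
by apply/andP; split; apply/eqP; ring.
Qed.

Lemma omegaX N a : omega R N ^+ a = cis (2 * pi * a%:R / N%:R).
Proof. by rewrite -[omega R N]/(cis _) cisX mulrAC. Qed.

Lemma cis_eq1 x : 0 < x < 2 * pi -> cis x != 1.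
Proof.
move=> /andP[x0 x2]; rewrite eq_complex /= negb_and; apply/orP; left.
have -> : x = x / 2 *+ 2 by rewrite mulr2n; lra.
rewrite cos_mulr2n cos2sin2.
have s0 : 0 < sin (x / 2) by apply: sin_gt0_pi; apply/andP; split; lra.
apply/eqP => E; have : sin (x / 2) ^+ 2 = 0 by move: E; rewrite mulr2n; lra.
by move/eqP; rewrite sqrf_eq0 gt_eqF.
Qed.

Lemma omega_prim N : (0 < N)%N -> N.-primitive_root (omega R N).
Proof.
move=> N0; have NR : 0 < N%:R :> R by rewrite ltr0n.
apply/andP; split=> //; apply/forallP => k; rewrite unity_rootE omegaX.
have [->|kN] := eqVneq k.+1 N.
  by rewrite mulfK ?lt0r_neq0 // mulr_natl /cis cos2pi sin2pi !eqxx.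
have ltkN : (k.+1 < N)%N by rewrite ltn_neqAle kN /=.
rewrite (negbTE (cis_eq1 _)) ?kN //.
have pi0 := pi_gt0 R; have kR : 0 < k.+1%:R :> R by rewrite ltr0n.
rewrite divr_gt0 ?mulr_gt0 //= ltr_pdivrMr // ltr_pM2l ?mulr_gt0 //.
by rewrite ltr_nat.
Qed.

Variable N : nat.
Hypothesis N0 : (0 < N)%N.

Definition cosk (a : nat) : R := cos (2 * pi * a%:R / N%:R).
Definition sink (a : nat) : R := sin (2 * pi * a%:R / N%:R).

Let w := omega R N.
Let wP : N.-primitive_root w := omega_prim N0.

Lemma cosk_omega a : (cosk a)%:C = 2^-1 * w ^+ a + 2^-1 * w^-1 ^+ a.
Proof. by rewrite cos_cis -omegaX mulrDr exprVn. Qed.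

Lemma sink_omega a : (sink a)%:C = (- 'i%C / 2) * w ^+ a + 'i%C / 2 * w^-1 ^+ a.
Proof. by rewrite sin_cis -omegaX mulrBr exprVn !mulNr opprK. Qed.

Lemma prim_rootV : N.-primitive_root w^-1.
Proof.
apply/andP; split=> //; apply/forallP=> k.
have /andP[_ /forallP/(_ k)] := wP.
by rewrite !unity_rootE exprVn invr_eq1.
Qed.

Lemma sampling_kernel_cos : sampling_kernel N (fun a => (cosk a)%:C).
Proof.
apply: (eq_sampling_kernel (fun a => esym (cosk_omega a))).
apply: sampling_kernelD; apply: sampling_kernelZ; apply: sampling_kernel_root => //.
exact: prim_rootV.
Qed.

Lemma sampling_kernel_sin : sampling_kernel N (fun a => (sink a)%:C).
Proof.
apply: (eq_sampling_kernel (fun a => esym (sink_omega a))).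
apply: sampling_kernelD; apply: sampling_kernelZ; apply: sampling_kernel_root => //.
exact: prim_rootV.
Qed.

Lemma dual_kernels_root : dual_kernels N 1 1 (fun a => w^-1 ^+ a) (fun a => w ^+ a).
Proof.
move=> a r; rewrite mul1n mul1r.
under eq_bigr => s _ do rewrite exprVn [(s * r)%N]mulnC.
by rewrite prim_root_orthogonal //; field.
Qed.

Lemma omega_neg a : w ^+ ((N - 1) * a) = w ^- a.
Proof.
have wa : w ^+ a != 0 by rewrite expf_neq0 // (prim_root_neq0 wP).
apply: (mulIf wa); rewrite mulVf // -exprD -mulSnr subn1 prednK //.
by rewrite exprM (prim_expr_order wP) expr1n.
Qed.

(** Cosine and sine are both of the form p w^a + q w^(-a), so one computation serves them: products
    of opposite exponents detect a = r, products of like exponents detect -a = r. *)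
Lemma omega_orthogonal a r (p q p' q' : R[i]) :
  \sum_(s < N) (p * w ^+ (a * s) + q * w^-1 ^+ (a * s))
             * (p' * w ^+ (s * r) + q' * w^-1 ^+ (s * r))
  = N%:R * ((p * q' + q * p') * (a == r %[mod N])%:R
            + (p * p' + q * q') * ((N - 1) * a == r %[mod N])%:R).
Proof.
have E s : (p * w ^+ (a * s) + q * w^-1 ^+ (a * s))
             * (p' * w ^+ (s * r) + q' * w^-1 ^+ (s * r)) =
   (p * q') * (w ^- (r * s) * w ^+ (a * s)) + (q * p') * (w ^- (a * s) * w ^+ (r * s))
   + ((p * p') * (w ^- ((N - 1) * a * s) * w ^+ (r * s))
   + (q * q') * (w ^- (r * s) * w ^+ ((N - 1) * a * s))).
  rewrite -[((N - 1) * a * s)%N]mulnA omega_neg invrK !exprVn [(s * r)%N]mulnC.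
  ring.
under eq_bigr => s _ do rewrite E.
rewrite !big_split /= -!mulr_sumr !prim_root_orthogonal //.
rewrite [r == a %[mod N]]eq_sym [r == _ * a %[mod N]]eq_sym.
ring.
Qed.

Lemma dual_kernels_cos :
  dual_kernels N (N - 1) 1 (fun a => (cosk a)%:C) (fun a => (cosk a)%:C).
Proof.
move=> a r; under eq_bigr => s _ do rewrite !cosk_omega.
by rewrite omega_orthogonal; field.
Qed.

Lemma dual_kernels_sin :
  dual_kernels N (N - 1) (-1) (fun a => (sink a)%:C) (fun a => (sink a)%:C).
Proof.
move=> a r; under eq_bigr => s _ do rewrite !sink_omega.
rewrite omega_orthogonal.
have ii : 'i%C * 'i%C = -1 :> R[i] by rewrite -expr2 sqr_i.
have -> : - 'i%C / 2 * ('i%C / 2) = 4^-1 :> R[i].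
  by rewrite mulrACA mulNr ii opprK mul1r -invfM -natrM.
have -> : 'i%C / 2 * (- 'i%C / 2) = 4^-1 :> R[i].
  by rewrite mulrACA mulrN ii opprK mul1r -invfM -natrM.
have -> : - 'i%C / 2 * (- 'i%C / 2) = - 4^-1 :> R[i].
  by rewrite mulrACA mulrNN ii mulN1r -invfM -natrM.
have -> : 'i%C / 2 * ('i%C / 2) = - 4^-1 :> R[i] by rewrite mulrACA ii mulN1r -invfM -natrM.
by field.
Qed.

End Trigonometry.

(** * Determinants of the Fourier, cosine and sine matrices *)

Section TriangularProducts.

Variable T : comNzRingType.

Lemma prod_triangle n (F : nat -> nat -> T) :
  \prod_(i < n) \prod_(j < n | (i < j)%N) F i j = \prod_(j < n) \prod_(i < j) F i j.
Proof.
rewrite (exchange_big_dep predT) //=; apply: eq_bigr => j _.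
by rewrite [RHS](big_ord_widen n (fun i => F i j)) // ltnW.
Qed.

Lemma prod_triangle_const n (a : T) : \prod_(j < n) \prod_(i < j) a = a ^+ 'C(n, 2).
Proof.
under eq_bigr => j _ do rewrite prodr_const card_ord.
by rewrite prodrXr -bin2_sum big_mkord.
Qed.

(** Each of the n + 1 indices lies in exactly n pairs. *)
Lemma prod_triangle_pairs n (f : nat -> T) :
  \prod_(j < n.+1) \prod_(i < j) (f i * f j) = (\prod_(i < n.+1) f i) ^+ n.
Proof.
elim: n => [|n IHn]; first by rewrite big_ord1 big_ord0.
rewrite big_ord_recr IHn /= [in RHS]big_ord_recr /= exprMn [in RHS]exprS.
by rewrite big_split /= prodr_const card_ord mulrA [_ ^+ n * _]mulrC.
Qed.

End TriangularProducts.

(** * Evaluation matrices of polynomials and Chebyshev polynomials *)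

(** The coefficient matrix is triangular with the leading coefficients on its diagonal; the other
    factor is a Vandermonde matrix. *)
Lemma det_poly_family (F : idomainType) n (p : nat -> {poly F}) (a : nat -> F) :
    (forall i, size (p i) = i.+1) ->
  \det (\matrix_(i < n, j < n) (p i).[a j]) =
  (\prod_(i < n) lead_coef (p i)) * \prod_(j < n) \prod_(i < j) (a j - a i).
Proof.
move=> sp; have -> : \matrix_(i < n, j < n) (p i).[a j] =
    (\matrix_(i < n, l < n) (p i)`_l) *m Vandermonde n (\row_j a j).
  apply/matrixP=> i j; rewrite !mxE (horner_coef_wide (n := n)) ?sp //.
  by apply: eq_bigr => l _; rewrite !mxE.
rewrite det_mulmx det_Vandermonde det_trig; last first.
  by apply/is_trig_mxP=> i j ij; rewrite mxE nth_default // sp.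
congr (_ * _); first by apply: eq_bigr => i _; rewrite mxE lead_coefE sp.
rewrite -(prod_triangle _ (fun i j => a j - a i)).
by apply: eq_bigr => i _; apply: eq_bigr => j _; rewrite !mxE.
Qed.

(* The Chebyshev polynomials of the first (q = 'X) and second (q = 2 'X) kind. *)
Fixpoint chebyshev (F : nzRingType) (q : {poly F}) (n : nat) : {poly F} :=
  match n with
  | 0 => 1
  | 1 => q
  | (m.+1 as m').+1 => 2 *: (chebyshev q m' * 'X) - chebyshev q m
  end.

Lemma chebyshevSS (F : nzRingType) (q : {poly F}) n :
  chebyshev q n.+2 = 2 *: (chebyshev q n.+1 * 'X) - chebyshev q n.
Proof. by []. Qed.

Section Chebyshev.

Variable R : realType.

(** Of the leading coefficient only the sign is recorded: orthogonality will give the modulus of the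
    determinants. *)
Lemma chebyshev_size (q : {poly R}) n : size q = 2 -> 0 < lead_coef q ->
  size (chebyshev q n) = n.+1 /\ 0 < lead_coef (chebyshev q n).
Proof.
move=> sq lq.
suff: (size (chebyshev q n) = n.+1 /\ 0 < lead_coef (chebyshev q n)) /\
      (size (chebyshev q n.+1) = n.+2 /\ 0 < lead_coef (chebyshev q n.+1)) by case.
elim: n => [|n [[s0 l0] [s1 l1]]]; first by rewrite size_poly1 lead_coef1 ltr01.
split=> //=; set p := chebyshev q n.+1 in s1 l1 *.
have p0 : p != 0 by rewrite -size_poly_gt0 s1.
have two0 : 2 != 0 :> R by rewrite pnatr_eq0.
have s2 : size (2 *: (p * 'X)) = n.+3 by rewrite size_scale // size_mulX // s1.
have lt : (size (- chebyshev q n) < size (2 *: (p * 'X)))%N by rewrite size_polyN s0 s2.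
by rewrite size_polyDl // lead_coefDl // s2 lead_coefZ lead_coefMX mulr_gt0.
Qed.

Lemma cos_step (x y : R) : cos (x + y) = 2 * (cos x * cos y) - cos (x - y).
Proof. by rewrite cosB cosD; ring. Qed.

Lemma sin_step (x y : R) : sin (x + y) = 2 * (sin x * cos y) - sin (x - y).
Proof. by rewrite sinB sinD; ring. Qed.

Lemma chebyshev_cos (x : R) n : (chebyshev 'X n).[cos x] = cos (n%:R * x).
Proof.
suff: (chebyshev 'X n).[cos x] = cos (n%:R * x) /\
      (chebyshev 'X n.+1).[cos x] = cos (n.+1%:R * x) by case.
elim: n => [|n [IH0 IH1]]; first by rewrite /= hornerC hornerX mul0r cos0 mul1r.
split=> //; rewrite chebyshevSS hornerD hornerN hornerZ hornerMX IH0 IH1.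
have -> : n.+2%:R * x = n.+1%:R * x + x by rewrite -natr1 mulrDl mul1r.
by rewrite cos_step; congr (_ - cos _); rewrite -[in RHS]natr1 mulrDl mul1r addrK.
Qed.

Lemma chebyshev_sin (x : R) n :
  sin x * (chebyshev (2 *: 'X) n).[cos x] = sin (n.+1%:R * x).
Proof.
suff: sin x * (chebyshev (2 *: 'X) n).[cos x] = sin (n.+1%:R * x) /\
      sin x * (chebyshev (2 *: 'X) n.+1).[cos x] = sin (n.+2%:R * x) by case.
elim: n => [|n [IH0 IH1]].
  rewrite /= hornerC hornerZ hornerX mul1r mulr1; split=> //.
  by rewrite [2%:R * x]mulr_natl mulr2n sinD; ring.
split=> //; rewrite chebyshevSS hornerD hornerN hornerZ hornerMX mulrBr IH0.
rewrite mulrCA [sin x * _]mulrA IH1.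
have -> : n.+3%:R * x = n.+2%:R * x + x by rewrite -natr1 mulrDl mul1r.
by rewrite sin_step; congr (_ - sin _); rewrite -[in RHS]natr1 mulrDl mul1r addrK.
Qed.

End Chebyshev.

(** The fixed points of r |-> -r modulo M are 0 and, for even M, M/2; the other residues come in
    pairs. *)
Lemma sum_fold (V : nmodType) (F : nat -> V) M : (0 < M)%N ->
    (forall r, (0 < r < M)%N -> F (M - r)%N = F r) ->
  \sum_(r < M) F r = F 0%N + (if (2 %| M)%N then F (M %/ 2)%N else 0)
    + (\sum_(1 <= r < (Nminus M).+1) F r) *+ 2.
Proof.
move=> M0 FM; set m := Nminus M.
have mE : M = (m + m + 1 + (2 %| M))%N.
  by rewrite /m /Nminus dvdn2; lia.
rewrite -(big_mkord xpredT) big_ltn //.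
rewrite (big_cat_nat (n := m.+1)) /=; [|lia|lia].
rewrite (big_cat_nat (n := (M - m)%N) (m := m.+1)) /=; [|lia|lia].
have -> : \sum_(M - m <= r < M) F r = \sum_(1 <= r < m.+1) F r.
  rewrite -[(M - m)%N]add0n big_addn big_add1 /= (_ : (M - (M - m) = m)%N); last by lia.
  rewrite big_nat_rev; apply: eq_big_nat => r /andP[_ rm].
  by rewrite -[RHS]FM; [congr F|]; lia.
have -> : \sum_(m.+1 <= r < M - m) F r = if (2 %| M)%N then F (M %/ 2)%N else 0.
  case: ifP mE => _ /= mE; last by rewrite big_geq //; lia.
  have -> : (M %/ 2 = m.+1)%N by lia.
  have -> : (M - m = m.+2)%N by lia.
  by rewrite big_nat1.
by rewrite -[RHS]addrA; congr (_ + _); rewrite addrCA mulr2n.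
Qed.

Lemma modn_neg N a : (0 < N)%N ->
  ((N - 1) * a %% N = if a %% N == 0 then 0 else N - a %% N)%N.
Proof.
move=> N0; have aN : (a %% N < N)%N by rewrite ltn_mod.
rewrite -modnMmr; case: (posnP (a %% N)%N) => [->|b0]; first by rewrite muln0 mod0n.
set b := (a %% N)%N in aN b0 *.
have -> : ((N - 1) * b = (b - 1) * N + (N - b))%N.
  by case: b b0 aN => // b _ bN; case: N bN {N0 a} => // N bN; rewrite !subn1 /=; nia.
by rewrite modnMDl modn_small //; lia.
Qed.

Section KernelDeterminants.

Variables (R : realType) (N : nat).
Hypothesis N2 : (2 <= N)%N.

Let N0 : (0 < N)%N. Proof. exact: leq_trans N2. Qed.
Let NR : 0 < N%:R :> R. Proof. by rewrite ltr0n. Qed.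

Lemma cos_orthogonal a r :
  \sum_(s < N) cosk R N (a * s) * cosk R N (s * r) =
  N%:R / 2 * ((a == r %[mod N])%:R + ((N - 1) * a == r %[mod N])%:R).
Proof.
apply: (@complexI R); rewrite rmorph_sum /=.
under eq_bigr => s _ do rewrite rmorphM /=.
by rewrite dual_kernels_cos // mul1r rmorphM rmorphD fmorph_div !rmorph_nat.
Qed.

Lemma sin_orthogonal a r :
  \sum_(s < N) sink R N (a * s) * sink R N (s * r) =
  N%:R / 2 * ((a == r %[mod N])%:R - ((N - 1) * a == r %[mod N])%:R).
Proof.
apply: (@complexI R); rewrite rmorph_sum /=.
under eq_bigr => s _ do rewrite rmorphM /=.
by rewrite dual_kernels_sin // mulN1r rmorphM rmorphB fmorph_div !rmorph_nat.
Qed.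

Lemma omega_sub a r : (r <= N)%N ->
  omega R N ^+ (a * (N - r)) = omega R N ^- (a * r).
Proof.
move=> rN; have w0 := prim_root_neq0 (omega_prim R N0).
have wr : omega R N ^+ (a * r) != 0 by rewrite expf_neq0.
apply: (mulIf wr); rewrite mulVf // -exprD -mulnDr subnK // mulnC exprM.
by rewrite (prim_expr_order (omega_prim R N0)) expr1n.
Qed.

Lemma cosk_neg a r : (r <= N)%N -> cosk R N (a * (N - r)) = cosk R N (a * r).
Proof.
move=> rN; apply: (@complexI R); rewrite !cosk_omega.
by rewrite !exprVn omega_sub // invrK addrC.
Qed.

Lemma sink_neg a r : (r <= N)%N -> sink R N (a * (N - r)) = - sink R N (a * r).
Proof.
move=> rN; apply: (@complexI R); rewrite rmorphN /= !sink_omega.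
by rewrite !exprVn omega_sub // invrK !mulNr opprD opprK addrC.
Qed.

Lemma angle_range k : (2 * k <= N)%N -> 2 * pi * k%:R / N%:R \in `[0, pi : R].
Proof.
move=> kN; rewrite in_itv /= divr_ge0 ?mulr_ge0 ?ler0n ?pi_ge0 //=.
rewrite ler_pdivrMr // mulrAC [leLHS]mulrC.
by rewrite ler_pM2l ?pi_gt0 // -natrM ler_nat.
Qed.

Lemma cosk_decr i j : (i < j)%N -> (2 * j <= N)%N -> cosk R N j < cosk R N i.
Proof.
move=> ij jN; rewrite /cosk ltr_cos ?angle_range //; last by lia.
by rewrite ltr_pM2r ?invr_gt0 // ltr_pM2l ?mulr_gt0 ?pi_gt0 // ltr_nat.
Qed.

(** Cosine decreases on [0, pi], so all of the 'C(n, 2) factors are negative. The nodes [f] start at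
    0 for the cosine matrix and at 1 for the sine matrix. *)
Lemma vandermonde_cos_sign n (f : nat -> nat) :
    (forall i j, (i < j)%N -> (j < n)%N -> (f i < f j)%N /\ (2 * f j <= N)%N) ->
  exists2 rho, 0 < rho & \prod_(j < n) \prod_(i < j) (cosk R N (f j) - cosk R N (f i))
    = (-1) ^+ 'C(n, 2) * rho.
Proof.
move=> fP; exists (\prod_(j < n) \prod_(i < j) (cosk R N (f i) - cosk R N (f j))).
  rewrite prodr_gt0 // => j _; rewrite prodr_gt0 // => i _.
  by have [fij fj] := fP _ _ (ltn_ord i) (ltn_ord j); rewrite subr_gt0 cosk_decr.
rewrite -prod_triangle_const -big_split; apply: eq_bigr => j _ /=.
by rewrite -big_split; apply: eq_bigr => i _ /=; rewrite mulN1r opprB.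
Qed.

Definition orbit_size (k : nat) : nat :=
  (if (k == 0) || (2 * k == N) then 1 else 2)%N.

Lemma orbit_size_small k : (1 <= k < (Nminus N).+1)%N -> orbit_size k = 2%N.
Proof. by rewrite /orbit_size /Nminus => /andP[k0 kN]; case: ifP => //; lia. Qed.

Lemma sum_orbits (F : nat -> R) : (forall r, (0 < r < N)%N -> F (N - r)%N = F r) ->
  \sum_(r < N) F r = \sum_(k < (Nplus N).+1) (orbit_size k)%:R * F k.
Proof.
move=> FN; rewrite sum_fold // -[RHS](big_mkord xpredT (fun k => (orbit_size k)%:R * F k)).
rewrite big_ltn // [in RHS](big_cat_nat (n := (Nminus N).+1)) /=;
  [|lia|rewrite /Nminus /Nplus; lia].
rewrite -addrA [orbit_size 0]/= mul1r. congr (_ + _); rewrite addrC; congr (_ + _).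
  rewrite -mulr_natl mulr_sumr; apply: eq_big_nat => k kN.
  by rewrite orbit_size_small.
case: ifP => N_even; last by rewrite big_geq //; rewrite /Nminus /Nplus; lia.
have -> : (Nplus N = (Nminus N).+1)%N by rewrite /Nplus /Nminus; lia.
rewrite big_nat1 /orbit_size.
have -> : (2 * (Nminus N).+1 == N)%N by rewrite /Nminus; lia.
by rewrite orbT mul1r; congr F; rewrite /Nminus; lia.
Qed.

Lemma prod_orbit_size : (\prod_(k < (Nplus N).+1) orbit_size k = 2 ^ Nminus N)%N.
Proof.
rewrite -(big_mkord xpredT) big_ltn // (big_cat_nat (n := (Nminus N).+1)) /=;
  [|lia|rewrite /Nminus /Nplus; lia].
rewrite [orbit_size 0]/= mul1n [X in (_ * X)%N]big1_seq ?muln1.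
  rewrite (eq_big_nat _ _ (F2 := fun=> 2%N)) => [|k]; last exact: orbit_size_small.
  by rewrite prod_nat_const_nat subn1.
move=> k; rewrite mem_index_iota => /andP[_]; rewrite /orbit_size /Nminus /Nplus => kN.
have -> : (2 * k == N)%N by lia.
by rewrite orbT.
Qed.

(** The sign comes from cos(i x) = T_i(cos x). For the modulus, let D be the diagonal matrix of
    orbit sizes: the weights turn sums over orbits into sums over a full period, so (K D)^2 = N, and
    det D is 2^(N^-). *)
Lemma det_cos : exists rho : R,
  [/\ 0 < rho,
      \det (\matrix_(i < (Nplus N).+1, k < (Nplus N).+1) cosk R N (i * k))
        = (-1) ^+ 'C((Nplus N).+1, 2) * rho
    & (rho * 2 ^+ Nminus N) ^+ 2 = N%:R ^+ (Nplus N).+1].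
Proof.
set n := (Nplus N).+1; set K := \matrix_(i, k) _.
have [rho rho0 vE] : exists2 rho, 0 < rho & \prod_(j < n) \prod_(i < j)
    (cosk R N j - cosk R N i) = (-1) ^+ 'C(n, 2) * rho.
  apply: (vandermonde_cos_sign (f := id)) => i j ij; rewrite /n /Nplus => jn.
  by split=> //; lia.
have sX : size ('X : {poly R}) = 2 by rewrite size_polyX.
have lX : 0 < lead_coef ('X : {poly R}) by rewrite lead_coefX.
have KE : K = \matrix_(i < n, k < n) (chebyshev 'X i).[cosk R N k].
  apply/matrixP=> i k; rewrite !mxE chebyshev_cos /cosk natrM.
  by congr cos; ring.
have detK : \det K =
    (-1) ^+ 'C(n, 2) * (rho * \prod_(i < n) lead_coef (chebyshev ('X : {poly R}) i)).
  rewrite KE det_poly_family => [|i]; last by have [] := chebyshev_size i sX lX.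
  by rewrite vE mulrC mulrA.
exists (rho * \prod_(i < n) lead_coef (chebyshev ('X : {poly R}) i)); split=> //.
  by rewrite mulr_gt0 // prodr_gt0 // => i _; have [] := chebyshev_size i sX lX.
set rho' := rho * _ in detK *.
pose D := diag_mx (\row_(k < n) (orbit_size k)%:R : 'rV[R]_n).
have gram : (K *m D) *m (K *m D) = N%:R%:M.
  apply/matrixP=> i j; rewrite /D !mul_mx_diag !mxE.
  transitivity ((\sum_(s < N) cosk R N (i * s) * cosk R N (s * j)) * (orbit_size j)%:R).
    rewrite (sum_orbits (F := fun s => cosk R N (i * s) * cosk R N (s * j)))
      ?mulr_suml => [|r /andP[_ /ltnW rN]].
      by apply: eq_bigr => k _; rewrite !mxE; ring.
    by rewrite ![(_ * j)%N]mulnC !cosk_neg.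
  rewrite cos_orthogonal modn_neg //.
  have [iN jN] : (2 * i <= N)%N /\ (2 * j <= N)%N.
    by have := ltn_ord i; have := ltn_ord j; rewrite /n /Nplus; lia.
  have [iN' jN'] : (i < N)%N /\ (j < N)%N by lia.
  rewrite !(modn_small iN') !(modn_small jN') /orbit_size -[i == j]val_eqE /=.
  case: (eqVneq (i : nat) (j : nat)) => [<-|ij] /=.
    have [i0|i0] := eqVneq (i : nat) 0%N; first by rewrite i0 eqxx /= mulr1; field.
    case: ifP => iN2.
      have -> : (N - i == i)%N by lia.
      by rewrite /= mulr1; field.
    have -> : (N - i == i)%N = false by lia.
    by rewrite addr0 mulr1 divfK ?pnatr_eq0.
  rewrite add0r (_ : ((if (i : nat) == 0%N then 0%N else (N - i)%N) == j) = false).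
    by rewrite mulr0 mul0r.
  by case: ifP; lia.
have := congr1 determinant gram.
rewrite !det_mulmx det_diag det_scalar -expr2.
under eq_bigr => k _ do rewrite mxE.
rewrite -natr_prod prod_orbit_size natrX detK -mulrA exprMn -exprM mulnC exprM.
by rewrite sqrrN !expr1n mul1r.
Qed.

(** Here sin((i + 1) x) = sin x U_i(cos x), and the sines split off are positive. The points 0 and
    N/2 do not contribute to the sine sums, so a full period is twice the range of the matrix and (2
    K)^2 = N. *)
Lemma det_sin : exists rho : R,
  [/\ 0 < rho,
      \det (\matrix_(i < Nminus N, k < Nminus N) sink R N (i.+1 * k.+1))
        = (-1) ^+ 'C(Nminus N, 2) * rho
    & (rho * 2 ^+ Nminus N) ^+ 2 = N%:R ^+ Nminus N].
Proof.
set n := Nminus N; set K := \matrix_(i, k) _.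
have [rho rho0 vE] : exists2 rho, 0 < rho & \prod_(j < n) \prod_(i < j)
    (cosk R N j.+1 - cosk R N i.+1) = (-1) ^+ 'C(n, 2) * rho.
  apply: (vandermonde_cos_sign (f := S)) => i j ij; rewrite /n /Nminus => jn.
  by split=> //; lia.
pose q : {poly R} := 2 *: 'X.
have two0 : 2 != 0 :> R by rewrite pnatr_eq0.
have sX : size q = 2 by rewrite size_scale // size_polyX.
have lX : 0 < lead_coef q by rewrite lead_coefZ lead_coefX mulr1.
have KE : K = (\matrix_(i < n, k < n) (chebyshev q i).[cosk R N k.+1])
               *m diag_mx (\row_(k < n) sink R N k.+1).
  apply/matrixP=> i k; rewrite mul_mx_diag !mxE mulrC chebyshev_sin /sink natrM.
  by congr sin; ring.
have sink_gt0 (k : 'I_n) : 0 < sink R N k.+1.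
  have := ltn_ord k; rewrite /n /Nminus => kn; apply: sin_gt0_pi; apply/andP; split.
    by rewrite divr_gt0 // !mulr_gt0 ?pi_gt0 // ltr0n.
  rewrite ltr_pdivrMr // mulrAC [ltLHS]mulrC.
  by rewrite ltr_pM2l ?pi_gt0 // -natrM ltr_nat; lia.
pose mu := (\prod_(i < n) lead_coef (chebyshev q i)) * \prod_(k < n) sink R N k.+1.
have mu0 : 0 < mu.
  by rewrite mulr_gt0 // prodr_gt0 // => i _; have [] := chebyshev_size i sX lX.
have detK : \det K = (-1) ^+ 'C(n, 2) * (rho * mu).
  rewrite KE det_mulmx det_diag (det_poly_family n (fun k => cosk R N k.+1)) => [|i];
    last by have [] := chebyshev_size i sX lX.
  by rewrite vE /mu; under [X in _ * X]eq_bigr => k _ do rewrite mxE; ring.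
exists (rho * mu); split=> //; first by rewrite mulr_gt0.
have gram : (2 *: K) *m (2 *: K) = N%:R%:M.
  apply/matrixP=> i j; rewrite -scalemxAl -scalemxAr scalerA !mxE.
  have -> : \sum_(k < n) K i k * K k j =
      (\sum_(s < N) sink R N (i.+1 * s) * sink R N (s * j.+1)) / 2.
    rewrite (sum_fold (F := fun s => sink R N (i.+1 * s) * sink R N (s * j.+1))) //
      => [|r /andP[_ /ltnW rN]]; last first.
      by rewrite ![(_ * j.+1)%N]mulnC !sink_neg // mulrNN.
    have s0 a : sink R N (a * 0) = 0 by rewrite muln0 /sink mulr0 mul0r sin0.
    rewrite s0 mul0r add0r (_ : (if _ then _ else _) = 0) ?add0r.
      have half (y : R) : y *+ 2 / 2 = y by field.
      rewrite half big_add1 big_mkord.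
      by apply: eq_bigr => k _; rewrite !mxE.
    case: ifP => // N_even; suff -> : sink R N (i.+1 * (N %/ 2)) = 0 by rewrite mul0r.
    have NN : (N - N %/ 2 = N %/ 2)%N by lia.
    have := @sink_neg i.+1 (N %/ 2) (leq_div _ _); rewrite NN => /eqP.
    by rewrite -subr_eq0 opprK -mulr2n mulrn_eq0 /= => /eqP.
  rewrite sin_orthogonal modn_neg //.
  have [iN jN] : (2 * i.+1 < N)%N /\ (2 * j.+1 < N)%N.
    by have := ltn_ord i; have := ltn_ord j; rewrite /n /Nminus; lia.
  have [iN' jN'] : (i.+1 < N)%N /\ (j.+1 < N)%N by lia.
  rewrite !(modn_small iN') !(modn_small jN') /= (_ : (N - i.+1 == j.+1)%N = false); last by lia.
  rewrite eqSS -[i == j]val_eqE /= subr0.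
  by case: eqP => _; rewrite /= ?mulr1n ?mulr0n; field.
have := congr1 determinant gram.
rewrite !det_mulmx detZ det_scalar -expr2 detK => <-.
have sign2 : ((-1) ^+ 'C(n, 2)) ^+ 2 = 1 :> R.
  by rewrite -exprM mulnC exprM sqrrN !expr1n.
by rewrite [in RHS]mulrCA [in RHS]exprMn sign2 mul1r [in RHS]mulrC.
Qed.

End KernelDeterminants.

(** * Determinant of the discrete Fourier matrix *)

Section DFTDeterminant.

Variable R : realType.

Lemma conj_cis (x : R) : ((cis x)^*)%C = cis (- x).
Proof. by rewrite /cis cosN sinN. Qed.

Lemma cis_oppi_half : cis (- (pi / 2)) = - 'i%C :> R[i].
Proof.
by rewrite /cis cosN sinN cos_pihalf sin_pihalf; apply/eqP; rewrite eq_complex /= oppr0 !eqxx.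
Qed.

Lemma cis_sub_cisV (x : R) : (cis x)^-1 - cis x = - 'i%C * (2 * sin x)%:C.
Proof.
rewrite rmorphM /= rmorph_nat sin_cis mulrCA mulrA mulrA.
have ii : 'i%C * 'i%C = -1 :> R[i] by rewrite -expr2 sqr_i.
have -> : 2 * - 'i%C * (- 'i%C / 2) = - 1 :> R[i].
  rewrite mulrA -[2 * - 'i%C * - 'i%C]mulrA mulrNN ii mulrN1 mulNr mulfV ?pnatr_eq0 //.
by rewrite mulN1r opprB.
Qed.

Lemma det_dft m : let N := m.+1 in exists rho : R,
  [/\ 0 < rho,
      \det (\matrix_(i < N, k < N) (omega R N)^-1 ^+ (i * k)%N)
        = (- 'i%C) ^+ ((m * (3 * N - 2)) %/ 2) * rho%:C
    & rho ^+ 2 = N%:R ^+ N].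
Proof.
move=> N; set w := omega R N; set K := \matrix_(i, k) _.
have N0 : (0 < N)%N by [].
have NR : 0 < N%:R :> R by rewrite ltr0n.
have wP : N.-primitive_root w := omega_prim R N0.
have wVE a : w^-1 ^+ a = cis (- (2 * pi * a%:R / N%:R)).
  by rewrite exprVn /w omegaX cisN.
(* Half-angle factorization: w^(-j) - w^(-i) is eta^(2 i) eta^(2 j) times -i times a positive sine.
   As eta^N = -i, the total phase will be a power of -i. *)
pose eta : R[i] := cis (- (pi / (2 * N%:R))).
have etaX a : eta ^+ (2 * a) = cis (- (pi * a%:R / N%:R)).
  by rewrite cisX natrM; congr cis; field; rewrite lt0r_neq0.
have etaN : eta ^+ N = - 'i%C.
  by rewrite cisX -cis_oppi_half; congr cis; field; rewrite lt0r_neq0.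
have diff i j : (i < j)%N -> w^-1 ^+ j - w^-1 ^+ i =
    (eta ^+ (2 * i) * eta ^+ (2 * j)) *
    (- 'i%C * (2 * sin (pi * (j - i)%:R / N%:R))%:C).
  move=> ij; rewrite -cis_sub_cisV !etaX !wVE -cisN mulrBr -!cisD natrB; last exact: ltnW.
  by congr (cis _ - cis _); field; rewrite lt0r_neq0.
pose rho : R := \prod_(j < N) \prod_(i < j) (2 * sin (pi * (j - i)%:R / N%:R)).
have rho0 : 0 < rho.
  rewrite prodr_gt0 // => j _; rewrite prodr_gt0 // => i _.
  rewrite mulr_gt0 // sin_gt0_pi // divr_gt0 ?mulr_gt0 ?pi_gt0 ?ltr0n ?subn_gt0 //=.
  by rewrite ltr_pdivrMr // ltr_pM2l ?pi_gt0 // ltr_nat (leq_ltn_trans (leq_subr _ _)).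
have detK : \det K = (- 'i%C) ^+ ((m * (3 * N - 2)) %/ 2) * rho%:C.
  have -> : K = Vandermonde N (\row_j w^-1 ^+ j).
    by apply/matrixP=> i k; rewrite !mxE -exprM mulnC.
  rewrite det_Vandermonde.
  under eq_bigr => i _ do under eq_bigr => j _ do rewrite !mxE.
  rewrite (prod_triangle N (fun i j => w^-1 ^+ j - w^-1 ^+ i)).
  under eq_bigr => j _ do (under eq_bigr => i _ do rewrite diff //; rewrite !big_split /=).
  rewrite !big_split /= -[X in X * _]big_split /=.
  under [X in X * _]eq_bigr => j _ do rewrite -big_split /=.
  rewrite (prod_triangle_pairs m (fun i => eta ^+ (2 * i))) prod_triangle_const mulrA.
  congr (_ * _); last by rewrite rmorph_prod; apply: eq_bigr => j _; rewrite rmorph_prod.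
  rewrite prodrXr -big_distrr /= -(big_mkord xpredT id) bin2_sum.
  (* The powers of eta multiply to eta^(2 m 'C(N, 2)) = eta^(N m^2) = (-i)^(m^2). Together with one
     -i from each of the 'C(N, 2) pairs, the exponent is m^2 + m N / 2 = m (3 N - 2) / 2. *)
  have bin2E : (2 * 'C(N, 2) = N * m)%N by rewrite -mul_bin_diag /= bin1.
  rewrite bin2E exprM etaN -exprM -exprD; congr (_ ^+ _).
  have -> : (m * (3 * N - 2) = (m * m + 'C(N, 2)) * 2)%N by rewrite /N in bin2E *; nia.
  by rewrite mulnK.
exists rho; split=> //.
(* [K] is symmetric, so [K'] is its adjoint, and K K' = N gives the modulus. *)
pose K' := map_mx (@conjc R) K.
have KK' : K *m K' = N%:R%:M.
  apply/matrixP=> i j; rewrite !mxE.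
  transitivity (\sum_(s < N) w ^- (i * s) * w ^+ (j * s)).
    apply: eq_bigr => s _; rewrite !mxE exprVn; congr (_ * _).
    by rewrite wVE conj_cis opprK /w omegaX mulnC.
  rewrite prim_root_orthogonal // !modn_small // -[i == j]val_eqE /=.
  by case: eqP; rewrite ?mul1r ?mul0r.
have := congr1 determinant KK'; rewrite det_mulmx det_scalar /K' det_map_mx detK.
rewrite rmorphM rmorphXn rmorphN /= => E; apply: (@complexI R).
rewrite !rmorphXn rmorph_nat -E.
have -> : rho -i* 0 = rho%:C by rewrite oppr0.
have -> : Complex 0 (-1) = - 'i%C :> R[i].
  by apply/eqP; rewrite eq_complex /= oppr0 !eqxx.
rewrite opprK mulrACA -exprMn mulNr -expr2 sqr_i opprK expr1n mul1r.
by rewrite expr2.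
Qed.

End DFTDeterminant.

(** The kernel determinant contributes a modulus with square N^n and inversion a factor N^(-n);
    together they make the real power N^(-n/2). *)
Lemma powR_half (R : realType) (N n : nat) (rho : R) : (0 < N)%N -> 0 < rho ->
  rho ^+ 2 = N%:R ^+ n -> rho / N%:R ^+ n = N%:R `^ (- (n%:R / 2)).
Proof.
move=> N0 rho0 rho2.
have -> : rho = N%:R `^ (n%:R / 2).
  apply/eqP; rewrite -(eqrXn2 (n := 2)) ?powR_ge0 ?(ltW rho0) //; apply/eqP.
  rewrite rho2 -[RHS]powR_mulrn ?powR_ge0 // -powRrM divfK ?pnatr_eq0 //.
  by rewrite powR_mulrn ?ler0n.
have p0 : N%:R `^ (n%:R / 2) != 0 :> R by rewrite lt0r_neq0 // powR_gt0 // ltr0n.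
rewrite powRN; apply: (mulIf p0); rewrite mulVf //.
have -> : N%:R ^+ n = N%:R `^ (n%:R / 2) * N%:R `^ (n%:R / 2) :> R.
  rewrite -expr2 -[RHS]powR_mulrn ?powR_ge0 // -powRrM divfK ?pnatr_eq0 //.
  by rewrite powR_mulrn ?ler0n.
by rewrite mulrAC divff // mulf_neq0.
Qed.

Section FourierDeterminant.

Variables (R : realType) (N h n : nat) (eps : R[i]).
Variables (rep : 'I_n -> nat) (c : 'I_n -> nat -> R[i]).
Variables (L : comAlgType R[i]) (x : nat -> L) (k k' : nat -> R[i]) (alpha gam : R[i]).

Lemma det_fourier : (0 < N)%N -> (0 < n)%N -> coprime h N -> eps * eps = 1 ->
    (forall j, equivariant N h eps (c j)) ->
    (forall i j, c i (rep j) = (i == j)%:R) ->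
    (forall f, equivariant N h eps f -> forall a, f a = \sum_j f (rep j) * c j a) ->
    equivariant N h eps k -> sampling_kernel N k' -> dual_kernels N h eps k k' ->
    alpha * gam * N%:R = 1 ->
    (forall a b, a = b %[mod N] -> x a = x b) ->
    (forall a, x (h * a)%N = eps *: x a) ->
  \det (\matrix_(i < n, j < n) x (rep i * rep j)%N) =
  (alpha ^+ n * \det (\matrix_(i < n, j < n) k (rep i * rep j)%N)) *:
  \prod_(d <- divisors N)
    \big[*%R/1]_(chi \in @equivariant_characters R h eps (N %/ d))
      (d%:R * \sum_(t : zunit (N %/ d)) chi t *: transform N x k' gam d (zval t)).
Proof.
case: n rep c => // n' rp cc N0 _ coh eps2 cE crep cexp kE kS kk agN xm xh.
have roots m : (0 < m)%N -> exists z : R[i], m.-primitive_root z.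
  by move=> m0; exists (omega R m); apply: omega_prim.
apply: (det_equivariant N0 coh cE crep cexp roots (x := transform N x k' gam 1)) kE _ _.
  by move=> d t; apply: transform_class.
exact: transform_inversion.
Qed.

End FourierDeterminant.

(** * The three determinants *)

Lemma modn_sub_neg N a : (0 < N)%N -> (a <= N)%N -> N - a = (N - 1) * a %[mod N].
Proof.
move=> N0 aN; rewrite modn_neg //; move: aN; rewrite leq_eqVlt => /predU1P[->|aN].
  by rewrite subnn modnn mod0n.
rewrite (modn_small aN); case: eqP => [->|/eqP a0]; first by rewrite subn0 modnn.
by rewrite modn_small //; lia.
Qed.

Section Assembly.

Variables (R : realType) (N : nat).
Hypothesis N2 : (2 <= N)%N.

Let N0 : (0 < N)%N. Proof. exact: leq_trans N2. Qed.
Let NR : N%:R != 0 :> R[i]. Proof. by rewrite pnatr_eq0 -lt0n. Qed.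

Lemma neg_coprime : coprime (N - 1) N.
Proof. by rewrite subn1 coprimePn. Qed.

Lemma neg_char (M : nat) (e : zunit M) : (M %| N)%N ->
  (zval e + 1 == 0 %[mod M])%N = (zval e == N - 1 %[mod M])%N.
Proof.
move=> MN; rewrite -[in RHS](eqn_modDr 1) subnK //.
by move: MN => /dvdnP[q ->]; rewrite modnMl mod0n.
Qed.

Lemma omega_div d a : (d %| N)%N -> omega R N ^+ (d * a) = omega R (N %/ d) ^+ a.
Proof.
move=> dN; rewrite !omegaX; have d0 := dvdn_gt0 N0 dN; have M0 := divisor_quo_gt0 N0 dN.
rewrite -[in LHS](divnK dN) !natrM; congr cis; field.
by rewrite !pnatr_eq0 -!lt0n d0 M0.
Qed.

Lemma cosk_div d t r : (d %| N)%N ->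
  cosk R N (t * (d * r)) = cos (2 * pi * t%:R * r%:R / (N %/ d)%:R).
Proof.
move=> dN; have d0 := dvdn_gt0 N0 dN; have M0 := divisor_quo_gt0 N0 dN.
rewrite /cosk -[in LHS](divnK dN) !natrM; congr cos; field.
by rewrite !pnatr_eq0 -!lt0n d0 M0.
Qed.

Lemma sink_div d t r : (d %| N)%N ->
  sink R N (t * (d * r)) = sin (2 * pi * t%:R * r%:R / (N %/ d)%:R).
Proof.
move=> dN; have d0 := dvdn_gt0 N0 dN; have M0 := divisor_quo_gt0 N0 dN.
rewrite /sink -[in LHS](divnK dN) !natrM; congr sin; field.
by rewrite !pnatr_eq0 -!lt0n d0 M0.
Qed.

Lemma det_X :
  \det (Xmx R N) =
    ('i%C ^- (((N - 1) * (3 * N - 2)) %/ 2)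
     * (N%:R `^ (- (N%:R / 2)) : R)%:C) *:
    \prod_(d <- divisors N)
      \big[*%R/1]_(chi \in characters R (N %/ d))
        (d%:R * \sum_(t : zunit (N %/ d)) chi t *: xhat R N d (zval t)).
Proof.
(* For h = 1 and eps = 1 every function on Z/N is equivariant, and the dual basis consists of the
   indicators of points. *)
pose c (k : 'I_N) (a : nat) : R[i] := (a %% N == k)%N%:R.
have wP := omega_prim R N0.
have := @det_fourier R N 1 N 1 (fun k => k) c {mpoly R[i][N]} (xvar R N)
  (fun a => (omega R N)^-1 ^+ a) (fun a => omega R N ^+ a) (N%:R^-1) 1.
have -> : (\matrix_(i < N, j < N) xvar R N (i * j)) = Xmx R N by [].
move=> ->; last 13 first.
- exact: N0.
- exact: N0.
- exact: coprime1n.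
- exact: mulr1.
- by move=> j; split=> [a b ab|a]; rewrite /c ?ab // mul1n mul1r.
- by move=> i j; rewrite /c modn_small // eq_sym.
- move=> f [fN _] a; have aN : (a %% N < N)%N by rewrite ltn_mod.
  rewrite (bigD1 (Ordinal aN)) //= /c eqxx mulr1 big1 ?addr0 => [|k ne].
    by apply: fN; rewrite modn_mod.
  by case: eqP => [E|]; rewrite ?mulr0 //; case/eqP: ne; apply: val_inj.
- split=> [a b ab|a]; last by rewrite mul1n mul1r.
  apply/eqP; rewrite !exprVn; apply/eqP; congr _^-1.
  by apply/eqP; rewrite (eq_prim_root_expr wP) ab.
- exact: sampling_kernel_root.
- exact: dual_kernels_root.
- by rewrite mulr1 mulVf.
- by move=> a b ab; rewrite /xvar ab.
- by move=> a; rewrite mul1n scale1r.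
have := det_dft R N.-1; rewrite prednK //= => -[rho [rho0 -> rho2]].
congr (_ *: _).
  rewrite -(powR_half N0 rho0 rho2) subn1 [RHS]mulrC rmorphM fmorphV rmorphXn rmorph_nat /=.
  have -> : (- 'i%C) = 'i%C^-1 :> R[i].
    have i0 : 'i%C != 0 :> R[i] by rewrite eq_complex /= oner_eq0 andbF.
    by apply: (mulIf i0); rewrite mulVf // mulNr -expr2 sqr_i opprK.
  by rewrite -!exprVn; ring.
rewrite !big_seq; apply: eq_bigr => d; rewrite -dvdn_divisors // => dN.
have -> : @equivariant_characters R 1 1 (N %/ d) = characters R (N %/ d).
  apply/seteqP; split=> [chi []//|chi chiC]; split=> // e e1.
  by case: chiC => _ + _; apply.
apply: eq_fsbigr => chi _; congr (_ * _); apply: eq_bigr => t _; congr (_ *: _).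
rewrite /transform scale1r /xhat big_mkord; apply: eq_bigr => r _.
by rewrite mulnCA omega_div.
Qed.

Lemma cosk_half t : (2 %| N)%N -> cosk R N (t * (N %/ 2)) = (-1) ^+ t.
Proof.
move=> N_even; rewrite /cosk.
have -> : 2 * pi * (t * (N %/ 2))%:R / N%:R = pi *+ t :> R.
  rewrite -mulr_natr -[in X in _ / X](divnK N_even) !natrM; field.
  by rewrite pnatr_eq0 -lt0n divn_gt0.
elim: t => [|t IHt]; first by rewrite mulr0n cos0.
by rewrite mulrSr cosDpi IHt exprS mulN1r.
Qed.

Lemma cosk_equivariant : equivariant N (N - 1) 1 (fun a => (cosk R N a)%:C).
Proof.
have wP := omega_prim R N0; split=> [a b /eqP ab|a].
  rewrite !cosk_omega !exprVn; suff -> : omega R N ^+ a = omega R N ^+ b by [].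
  by apply/eqP; rewrite (eq_prim_root_expr wP).
by rewrite mul1r !cosk_omega !exprVn omega_neg // invrK addrC.
Qed.

Lemma sink_equivariant : equivariant N (N - 1) (-1) (fun a => (sink R N a)%:C).
Proof.
have wP := omega_prim R N0; split=> [a b /eqP ab|a].
  rewrite !sink_omega !exprVn; suff -> : omega R N ^+ a = omega R N ^+ b by [].
  by apply/eqP; rewrite (eq_prim_root_expr wP).
by rewrite mulN1r !sink_omega !exprVn omega_neg // invrK; ring.
Qed.

Definition fold_mod (a : nat) : nat := minn (a %% N) (N - a %% N).

Lemma fold_mod_neg a : fold_mod ((N - 1) * a) = fold_mod a.
Proof.
have aN : (a %% N < N)%N by rewrite ltn_mod.
by rewrite /fold_mod modn_neg //; case: eqP => [->|a0]; lia.
Qed.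

Lemma fold_mod_lt a : (fold_mod a < (Nplus N).+1)%N.
Proof. by rewrite /fold_mod /Nplus; have : (a %% N < N)%N by [rewrite ltn_mod]; lia. Qed.

Lemma fold_mod_small k : (k < (Nplus N).+1)%N -> fold_mod k = k.
Proof. by rewrite /fold_mod /Nplus => kN; rewrite modn_small; lia. Qed.

Lemma fold_modP a : a = fold_mod a %[mod N] \/ a = (N - 1) * fold_mod a %[mod N].
Proof.
have aN : (a %% N < N)%N by rewrite ltn_mod.
rewrite /fold_mod /minn; case: ifP => _; first by left; rewrite modn_mod.
by right; rewrite -modn_sub_neg ?leq_subr // subKn ?modn_mod // ltnW.
Qed.

Lemma yvar_neg a : yvar R N ((N - 1) * a) = yvar R N a.
Proof. by rewrite /yvar -!/(fold_mod _) fold_mod_neg. Qed.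

Lemma yvar_mod a b : a = b %[mod N] -> yvar R N a = yvar R N b.
Proof. by rewrite /yvar => ->. Qed.

Lemma transform_yvar d t : (d %| N)%N ->
  transform N (yvar R N) (fun a => (cosk R N a)%:C) 2^-1 d t = yhat R N d t.
Proof.
move=> dN; have M0 := divisor_quo_gt0 N0 dN.
pose F r := (cosk R N (t * (d * r)))%:C *: yvar R N (d * r).
rewrite /transform -/(F _) (sum_fold (F := F)) // => [|r /andP[_ rM]].
  rewrite /yhat !scalerDr; congr (_ + _ + _).
  - by rewrite /F !muln0 /cosk mulr0 mul0r cos0 scale1r.
  - case: ifP => // M_even; last by rewrite scaler0.
    have N_even : (2 %| N)%N by rewrite -(divnK dN) dvdn_mulr.
    by rewrite /F muln_divA // [(d * _)%N]mulnC divnK // cosk_half // rmorphXn rmorphN1 scalerA.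
  rewrite -scalerDl (_ : 2^-1 + 2^-1 = 1) ?scale1r; last by field.
  by apply: eq_bigr => r _; rewrite /F cosk_div.
have rN : (d * r <= N)%N by rewrite -[leqRHS](divnK dN) mulnC leq_mul2r ltnW ?orbT.
rewrite /F mulnBr [(d * (N %/ d))%N]mulnC divnK // cosk_neg //.
by rewrite (yvar_mod (modn_sub_neg N0 rN)) yvar_neg.
Qed.

Lemma det_Y :
  \det (Ymx R N) =
    ((-1) ^+ ((Nplus N * (Nplus N + 1)) %/ 2)
     * 2 ^+ (Nplus N + 1 - Nminus N)
     * (N%:R `^ (- ((Nplus N + 1)%:R / 2)) : R)%:C) *:
    \prod_(d <- divisors N)
      \big[*%R/1]_(chi \in even_characters R (N %/ d))
        (d%:R * \sum_(t : zunit (N %/ d)) chi t *: yhat R N d (zval t)).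
Proof.
set n := (Nplus N).+1.
pose c (k : 'I_n) (a : nat) : R[i] := (fold_mod a == k)%N%:R.
(* [yhat] is half of a sum over a full period, whence [gam] = 1/2, and inversion then requires
   [alpha] = 2/N. *)
have := @det_fourier R N (N - 1) n 1 (fun k => k) c {mpoly R[i][n]} (yvar R N)
  (fun a => (cosk R N a)%:C) (fun a => (cosk R N a)%:C) (2 / N%:R) 2^-1.
have -> : (\matrix_(i < n, j < n) yvar R N (i * j)) = Ymx R N by [].
move=> ->; last 13 first.
- exact: N0.
- by [].
- exact: neg_coprime.
- exact: mulr1.
- move=> j; split=> [a b ab|a]; rewrite /c ?mul1r ?fold_mod_neg //.
  by rewrite /fold_mod ab.
- by move=> i j; rewrite /c fold_mod_small // eq_sym.
- move=> f [fN fh] a.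
  rewrite (bigD1 (Ordinal (fold_mod_lt a))) //= /c eqxx mulr1 big1 ?addr0 => [|k ne].
    by have [/fN|/fN ->] := fold_modP a; rewrite ?fh ?mul1r.
  by case: eqP => [E|]; rewrite ?mulr0 //; case/eqP: ne; apply: val_inj.
- exact: cosk_equivariant.
- exact: sampling_kernel_cos.
- exact: dual_kernels_cos.
- by field; rewrite NR.
- exact: yvar_mod.
- by move=> a; rewrite yvar_neg scale1r.
have [rho [rho0 detK rho2]] := det_cos R N2.
have -> : \det (\matrix_(i < n, j < n) (cosk R N (i * j))%:C) = ((-1) ^+ 'C(n, 2) * rho)%:C.
  rewrite -detK -det_map_mx; congr determinant.
  by apply/matrixP=> i j; rewrite !mxE.
congr (_ *: _).
  have A0 : 0 < 2 ^+ Nminus N :> R by rewrite exprn_gt0.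
  rewrite addn1 -/n -(powR_half N0 (mulr_gt0 rho0 A0) rho2).
  have le : (Nminus N <= n)%N by rewrite /n /Nminus /Nplus; lia.
  have -> : (Nplus N * n %/ 2 = 'C(n, 2))%N by rewrite bin2 /n /= mulnC divn2.
  (* The numerator of [alpha ^+ n] is 2^n, of which the orbit sizes in [rho2] absorb 2^(N^-). *)
  have pow2 : 2 ^+ n = 2 ^+ (n - Nminus N) * 2 ^+ Nminus N :> R[i].
    by rewrite -exprD subnK.
  rewrite !rmorphM fmorphV !rmorphXn rmorphN1 !rmorph_nat /=.
  by rewrite exprMn exprVn pow2; ring.
rewrite !big_seq; apply: eq_bigr => d; rewrite -dvdn_divisors // => dN.
have MN := dvdn_div dN.
have -> : @equivariant_characters R (N - 1) 1 (N %/ d) = even_characters R (N %/ d).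
  apply/seteqP; split=> [chi [chiC chi1]|chi [chiC chi1]]; split=> // e.
    by move=> /eqP; rewrite neg_char // => /eqP; apply: chi1.
  by move=> /eqP; rewrite -neg_char // => /eqP; apply: chi1.
apply: eq_fsbigr => chi _; congr (_ * _); apply: eq_bigr => t _; congr (_ *: _).
exact: transform_yvar.
Qed.

Lemma zvar_mod a b : a = b %[mod N] -> zvar R N a = zvar R N b.
Proof. by rewrite /zvar => ->. Qed.

Lemma zvar_neg a : zvar R N ((N - 1) * a) = - zvar R N a.
Proof.
have aN : (a %% N < N)%N by rewrite ltn_mod.
rewrite /zvar modn_neg //; set b := (a %% N)%N in aN *.
case: (eqVneq b 0%N) => [_|b0] /=; first by rewrite oppr0.
have -> : (N - b == 0)%N = false by lia.
have -> : (2 * (N - b) == N)%N = (2 * b == N)%N by lia.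
case: (eqVneq (2 * b)%N N) => [_|b2] /=; first by rewrite oppr0.
have -> : (N - b <= Nminus N)%N = ~~ (b <= Nminus N)%N by rewrite /Nminus; lia.
by case: (leqP b (Nminus N)) => _ /=; rewrite ?opprK //; congr (- indet _ _ _); lia.
Qed.

Lemma transform_zvar d t : (d %| N)%N ->
  transform N (zvar R N) (fun a => (sink R N a)%:C) 2^-1 d t = zhat R N d t.
Proof.
move=> dN; have M0 := divisor_quo_gt0 N0 dN.
pose F r := (sink R N (t * (d * r)))%:C *: zvar R N (d * r).
rewrite /transform -/(F _) (sum_fold (F := F)) // => [|r /andP[_ rM]].
  rewrite (_ : (if _ then _ else _) = 0) ?addr0.
    rewrite [F 0%N]/F !muln0 /zvar mod0n /= scaler0 add0r -/(zvar R N _).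
    rewrite mulr2n scalerDr -scalerDl (_ : 2^-1 + 2^-1 = 1) ?scale1r; last by field.
    by apply: eq_bigr => r _; rewrite /F sink_div.
  case: ifP => // M_even.
  have N_even : (2 %| N)%N by rewrite -(divnK dN) dvdn_mulr.
  rewrite /F; have -> : (d * (N %/ d %/ 2) = N %/ 2)%N by rewrite muln_divA // mulnC divnK.
  rewrite /zvar modn_small ?ltn_Pdiv // [(2 * _)%N]mulnC divnK // eqxx orbT.
  by rewrite scaler0.
have rN : (d * r <= N)%N by rewrite -[leqRHS](divnK dN) mulnC leq_mul2r ltnW ?orbT.
rewrite /F mulnBr [(d * (N %/ d))%N]mulnC divnK // sink_neg //.
by rewrite (zvar_mod (modn_sub_neg N0 rN)) zvar_neg rmorphN scaleNr scalerN opprK.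
Qed.

(** For M at most 2 one has -1 = 1 modulo M, where a character takes the value 1. The levels with
    N/d at most 2 therefore give empty products. *)
Lemma odd_character_quo_gt2 (M : nat) (chi : {ffun zunit M -> R[i]}) :
  (0 < M)%N -> (M %| N)%N -> equivariant_characters (N - 1) (-1) chi -> (2 < M)%N.
Proof.
move=> M0 MN [[_ chi1 _] chiN]; rewrite ltnNge; apply/negP=> M2.
have [e e1] := zunit_exists M0 (coprime1n M).
have e1' : zval e = 1 %[mod M] by rewrite e1 modn_mod.
have eN : zval e = N - 1 %[mod M].
  apply/eqP; rewrite -neg_char // -modnDml e1' modnDml mod0n.
  by case: (M) M0 M2 => [|[|[]]].
have := chiN e eN; rewrite chi1 // => /eqP.
by rewrite -subr_eq0 opprK -mulr2n pnatr_eq0.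
Qed.

(** The basis functions are the indicator of k + 1 minus that of -(k + 1). At 0 and at N/2 an odd
    function equals its own negative, so it vanishes there. *)
Lemma odd_equivariant_expand (f : nat -> R[i]) : equivariant N (N - 1) (-1) f ->
  forall a, f a = \sum_(k < Nminus N) f k.+1 *
    ((a == k.+1 %[mod N])%:R - ((N - 1) * a == k.+1 %[mod N])%:R).
Proof.
move=> [fN fh] a; have aN : (a %% N < N)%N by rewrite ltn_mod.
have kN (k : 'I_(Nminus N)) : (k.+1 %% N = k.+1)%N.
  by rewrite modn_small //; have := ltn_ord k; rewrite /Nminus; lia.
have -> : f a = f (a %% N)%N by apply: fN; rewrite modn_mod.
under eq_bigr => k _ do rewrite kN modn_neg //.
have fh' : f ((N - 1) * (a %% N))%N = - f (a %% N)%N by rewrite fh mulN1r.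
set b := (a %% N)%N in aN fh' *.
have f0 : (N - 1) * b = b %[mod N] -> f b = 0.
  move=> /fN; rewrite fh' => /eqP; rewrite -subr_eq0 -opprD oppr_eq0 -mulr2n.
  by rewrite mulrn_eq0 => /eqP.
rewrite modn_neg // (modn_small aN) in f0. clearbody b.
case: (eqVneq b 0%N) f0 => [b0 f0|b0 f0] /=.
  by rewrite f0 ?b0 // big1 // => k _; rewrite subrr mulr0.
have [b2|b2] := boolP (2 * b == N)%N.
  rewrite f0; last by lia.
  rewrite big1 // => k _; have kn : (k < (N - 1) %/ 2)%N := ltn_ord k.
  have -> : (b == k.+1)%N = false by lia.
  by have -> : (N - b == k.+1)%N = false; [lia | rewrite subrr mulr0].
have [bN|bN] := leqP b (Nminus N).
  have lt : (b - 1 < Nminus N)%N by lia.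
  rewrite (bigD1 (Ordinal lt)) //= big1 => [|k ne].
    have -> : ((b - 1).+1 = b)%N by lia.
    rewrite eqxx (_ : (N - b == b)%N = false) ?subr0 ?mulr1 ?addr0 //.
    by move: bN; rewrite /Nminus; lia.
  have kn : (k < (N - 1) %/ 2)%N := ltn_ord k; rewrite /Nminus in bN.
  have -> : (b == k.+1)%N = false.
    by apply/eqP=> bk; case/eqP: ne; apply: val_inj; rewrite /= bk subn1.
  by have -> : (N - b == k.+1)%N = false; [lia | rewrite subrr mulr0].
have lt : (N - b - 1 < Nminus N)%N by move: bN; rewrite /Nminus; lia.
rewrite (bigD1 (Ordinal lt)) //= big1 => [|k ne].
  have -> : ((N - b - 1).+1 = N - b)%N by lia.
  rewrite eqxx (_ : (b == N - b)%N = false) ?sub0r ?mulrN1 ?addr0; last by lia.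
  by rewrite (fN (N - b)%N ((N - 1) * b)%N) ?modn_sub_neg 1?ltnW // fh' opprK.
have kn : (k < (N - 1) %/ 2)%N := ltn_ord k; rewrite /Nminus in bN.
have -> : (N - b == k.+1)%N = false.
  by apply/eqP=> bk; case/eqP: ne; apply: val_inj; rewrite /= bk subn1.
by have -> : (b == k.+1)%N = false; [lia | rewrite subrr mulr0].
Qed.

Lemma det_Z :
  \det (Zmx R N) =
    ((-1) ^+ ((Nminus N * (Nminus N - 1)) %/ 2)
     * (N%:R `^ (- ((Nminus N)%:R / 2)) : R)%:C) *:
    \prod_(d <- divisors N | (2 < N %/ d)%N)
      \big[*%R/1]_(chi \in odd_characters R (N %/ d))
        (d%:R * \sum_(t : zunit (N %/ d)) chi t *: zhat R N d (zval t)).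
Proof.
(* For N = 2 the matrix is empty and no level has N/d > 2, so both sides are 1. The eigenbasis
   argument takes over in positive dimension. *)
have [n0|n0] := posnP (Nminus N).
  have NE : N = 2 by move: n0 N2; rewrite /Nminus; lia.
  rewrite big_seq_cond big1 => [|d /andP[_]]; last first.
    by rewrite NE => /leq_trans/(_ (leq_div 2 d)).
  have -> : \det (Zmx R N) = 1 by move: (Zmx R N); rewrite n0 => A; rewrite det_mx00.
  set a := _ * _; suff -> : a = 1 by rewrite scale1r.
  by rewrite /a n0 mul0r oppr0 powRr0 mul0n div0n expr0 mul1r.
set n := Nminus N.
pose c (k : 'I_n) (a : nat) : R[i] :=
  (a == k.+1 %[mod N])%:R - ((N - 1) * a == k.+1 %[mod N])%:R.
have := @det_fourier R N (N - 1) n (-1) (fun k => k.+1) c {mpoly R[i][n]} (zvar R N)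
  (fun a => (sink R N a)%:C) (fun a => (sink R N a)%:C) (2 / N%:R) 2^-1.
have -> : (\matrix_(i < n, j < n) zvar R N (i.+1 * j.+1)) = Zmx R N by [].
move=> ->; last 13 first.
- exact: N0.
- exact: n0.
- exact: neg_coprime.
- by rewrite mulrNN mulr1.
- move=> j; split=> [a b ab|a].
    rewrite /c ab; suff -> : (N - 1) * a = (N - 1) * b %[mod N] by [].
    by rewrite -modnMmr ab modnMmr.
  have NN : ((N - 1) * (N - 1) = 1 %[mod N])%N.
    rewrite modn_neg // !modn_small; [|lia|lia].
    by have -> : (N - 1 == 0)%N = false; lia.
  rewrite /c mulN1r opprB mulnA -[((N - 1) * (N - 1) * a %% N)%N]modnMml NN.
  by rewrite modnMml mul1n.
- move=> i j; have iN : (i < (N - 1) %/ 2)%N := ltn_ord i.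
  have jN : (j < (N - 1) %/ 2)%N := ltn_ord j.
  rewrite /c modn_neg // !(modn_small (m := _.+1)); [|lia|lia].
  rewrite /= (_ : (N - j.+1 == i.+1)%N = false); last by lia.
  by rewrite subr0 eqSS eq_sym.
- exact: odd_equivariant_expand.
- exact: sink_equivariant.
- exact: sampling_kernel_sin.
- exact: dual_kernels_sin.
- by field; rewrite NR.
- exact: zvar_mod.
- by move=> a; rewrite zvar_neg scaleN1r.
have [rho [rho0 detK rho2]] := det_sin R N2.
have -> : \det (\matrix_(i < n, j < n) (sink R N (i.+1 * j.+1))%:C) = ((-1) ^+ 'C(n, 2) * rho)%:C.
  rewrite -detK -det_map_mx; congr determinant.
  by apply/matrixP=> i j; rewrite !mxE.
congr (_ *: _).
  (* The 2^n of [alpha ^+ n] is exactly the power of two in [rho2], so none remains. *)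
  have A0 : 0 < 2 ^+ n :> R by rewrite exprn_gt0.
  rewrite -(powR_half N0 (mulr_gt0 rho0 A0) rho2).
  have -> : (n * (n - 1) %/ 2 = 'C(n, 2))%N by rewrite bin2 subn1 divn2.
  rewrite !rmorphM fmorphV !rmorphXn rmorphN1 !rmorph_nat /=.
  by rewrite exprMn exprVn; ring.
rewrite [RHS]big_mkcond !big_seq; apply: eq_bigr => d; rewrite -dvdn_divisors // => dN.
have MN := dvdn_div dN; have M0 := divisor_quo_gt0 N0 dN.
case: ifP => M2; last first.
  suff -> : @equivariant_characters R (N - 1) (-1) (N %/ d) = set0 by rewrite fsbig_set0.
  by apply/seteqP; split=> // chi /(odd_character_quo_gt2 M0 MN); rewrite M2.
have -> : @equivariant_characters R (N - 1) (-1) (N %/ d) = odd_characters R (N %/ d).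
  apply/seteqP; split=> [chi [chiC chi1]|chi [chiC chi1]]; split=> // e.
    by move=> /eqP; rewrite neg_char // => /eqP; apply: chi1.
  by move=> /eqP; rewrite -neg_char // => /eqP; apply: chi1.
apply: eq_fsbigr => chi _; congr (_ * _); apply: eq_bigr => t _; congr (_ *: _).
exact: transform_zvar.
Qed.

End Assembly.

Unset Implicit Arguments.

Theorem theorem2p5 (R : realType) (N : nat) (hN : (2 <= N)%N) :
  [/\ \det (Xmx R N) =
        ('i%C ^- (((N - 1) * (3 * N - 2)) %/ 2)
         * (N%:R `^ (- (N%:R / 2)) : R)%:C) *:
        \prod_(d <- divisors N)
          \big[*%R/1]_(chi \in characters R (N %/ d))
            (d%:R * \sum_(t : zunit (N %/ d)) chi t *: xhat R N d (zval t)),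
      \det (Ymx R N) =
        ((-1) ^+ ((Nplus N * (Nplus N + 1)) %/ 2)
         * 2 ^+ (Nplus N + 1 - Nminus N)
         * (N%:R `^ (- ((Nplus N + 1)%:R / 2)) : R)%:C) *:
        \prod_(d <- divisors N)
          \big[*%R/1]_(chi \in even_characters R (N %/ d))
            (d%:R * \sum_(t : zunit (N %/ d)) chi t *: yhat R N d (zval t))
    & \det (Zmx R N) =
        ((-1) ^+ ((Nminus N * (Nminus N - 1)) %/ 2)
         * (N%:R `^ (- ((Nminus N)%:R / 2)) : R)%:C) *:
        \prod_(d <- divisors N | (2 < N %/ d)%N)
          \big[*%R/1]_(chi \in odd_characters R (N %/ d))
            (d%:R * \sum_(t : zunit (N %/ d)) chi t *: zhat R N d (zval t))].
Proof. by split; [exact: det_X | exact: det_Y | exact: det_Z]. Qed.
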